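(* Let $p$ be an odd prime and $r\ge3$ with $p\nmid r$. The number of (isomorphism classes of) irreducible rotary augmented PX maps of length $r$ is $|\mathrm{Irr}(\mathrm{D}_{2r})|$ if $r$ is odd, and $|\mathrm{Irr}(\mathrm{D}_{2r})|-1$ if $r$ is even.
   Context: $\mathrm{Irr}(\mathrm{D}_{2r})$ is the set of isomorphism classes of irreducible representations of the dihedral group $\mathrm{D}_{2r}$ over $\mathbb{F}_p$. The augmented Praeger–Xu graph $\mathrm{C}^*(p,r,s,\delta)$ (of length $r$) is: for $s\ge1$, the graph with vertex set $\mathbb{Z}_r\times\mathbb{Z}_p^s$ and edges $\{(i,x_0,\dots,x_{s-1}),(i+1,x_1,\dots,x_s)\}$; for $s=0,\delta=1$, the cycle of length $r$ with $p$ parallel edges between adjacent vertices; for $s=0,\delta=-1$, the cycle $\mathrm{C}_{pr}$. A map is a 2-cell embedding of a connected graph (multiple edges allowed, no loops) in a closed orientable surface; it is rotary if its orientation-preserving automorphism group $G$ is arc-transitive (then arc-regular). An augmented PX map of length $r$ is a map whose underlying graph is an augmented Praeger–Xu graph of length $r$. A rotary augmented PX map is irreducible if its arc-regular group $G$ is isomorphic to $\mathbb{Z}_p^{d}\rtimes_\psi\mathrm{D}_{2r}$ with $\psi$ an irreducible representation over $\mathbb{F}_p$. *)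

(* Defs.v *)
From HB Require Import structures.
From mathcomp Require Import all_boot all_order all_algebra all_fingroup all_solvable.
From mathcomp Require Import mxrepresentation mxabelem.

Set Implicit Arguments.
Unset Strict Implicit.
Unset Printing Implicit Defensive.

Local Open Scope group_scope.

(* 'D_m (mathcomp solvable/extremal) is the dihedral group of order m.      *)

Definition num_irr_reps (F : fieldType) (gT : finGroupType) (G : {group gT})
    (k : nat) : Prop :=
  exists (dims : 'I_k -> nat) (reps : forall i, mx_representation F G (dims i)),
    [/\ forall i, mx_irreducible (reps i),
        forall i j, mx_rsim (reps i) (reps j) -> i = j &
        forall n (rho : mx_representation F G n),
          mx_irreducible rho -> exists i, mx_rsim rho (reps i)].

(* A map on the dart (arc) set D is given by the rotation R (cyclic order   *)
(* of darts around each vertex) and the dart-reversing involution L.        *)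
(* Vertices = cycles of R, edges = orbits of L.                             *)

Record omap (D : finType) := OMap { mR : {perm D}; mL : {perm D} }.

Definition mon (D : finType) (M : omap D) : {group {perm D}} :=
  <<[set mR M; mL M]>>%G.

(* M is a map: L is a fixed-point-free involution, the underlying graph is  *)
(* connected (<R,L> transitive on darts) and has no loops (the two darts of *)
(* an edge never lie at the same vertex).                                   *)
Definition is_map (D : finType) (M : omap D) : Prop :=
  [/\ forall x, mL M (mL M x) = x,
      forall x, mL M x != x,
      [transitive mon M, on [set: D] | 'P] &
      forall x, mL M x \notin porbit (mR M) x].

(* orientation-preserving automorphism group: permutations of the darts     *)
(* commuting with R and L.                                                  *)
Definition autp (D : finType) (M : omap D) : {group {perm D}} :=
  'C(mon M)%G.

Definition rotary (D : finType) (M : omap D) : Prop :=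
  [transitive autp M, on [set: D] | 'P].

(* Map isomorphism: a bijection of darts carrying edges to edges and        *)
(* rotations to rotations, either preserving or reversing the orientation.  *)
Definition map_iso (D1 D2 : finType) (M1 : omap D1) (M2 : omap D2) : Prop :=
  exists f : D1 -> D2,
    [/\ bijective f,
        forall x, f (mL M1 x) = mL M2 (f x) &
        (forall x, f (mR M1 x) = mR M2 (f x)) \/
        (forall x, f (mR M1 x) = (mR M2)^-1 (f x))].

(* Loopless multigraphs given by their arcs: each arc has a tail vertex and *)
(* a reverse arc (the same edge traversed in the other direction).          *)

Record agraph := AGraph {
  arc : finType;
  vert : finType;
  arev : arc -> arc;
  atail : arc -> vert }.

Definition graph_iso (D : finType) (M : omap D) (Gam : agraph) : Prop :=
  exists f : D -> arc Gam,
    [/\ bijective f,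
        forall x, f (mL M x) = arev (f x),
        forall x y, (atail (f x) == atail (f y)) = (y \in porbit (mR M) x) &
        forall v : vert Gam, exists a, atail a = v].

(* Augmented Praeger-Xu graph C*(p, r, s, 1) (s >= 0; for s >= 1 delta is   *)
(* irrelevant): vertices Z_r x Z_p^s, edges indexed by Z_r x Z_p^(s+1), the *)
(* edge (i, x_0..x_s) joining (i, x_0..x_(s-1)) and (i+1, x_1..x_s).        *)
(* Arcs are (edge, b) with b = false the arc starting at the first end.     *)
Definition PX_arc (p r s : nat) : finType :=
  ('Z_r * {ffun 'I_s.+1 -> 'Z_p} * bool)%type.
Definition PX_vert (p r s : nat) : finType := ('Z_r * {ffun 'I_s -> 'Z_p})%type.

Definition PX_rev (p r s : nat) (a : PX_arc p r s) : PX_arc p r s :=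
  (a.1, ~~ a.2).

Definition PX_tail (p r s : nat) (a : PX_arc p r s) : PX_vert p r s :=
  let: (i, x, b) := a in
  if b then ((i + 1)%R, [ffun j : 'I_s => x (lift ord0 j)])
  else (i, [ffun j : 'I_s => x (widen_ord (leqnSn s) j)]).

Definition PXgraph (p r s : nat) : agraph :=
  @AGraph (PX_arc p r s) (PX_vert p r s) (@PX_rev p r s) (@PX_tail p r s).

(* C*(p, r, 0, -1): the cycle C_{pr}; edge j joins j and j+1.               *)
Definition Cyc_arc (n : nat) : finType := ('Z_n * bool)%type.
Definition Cyc_rev (n : nat) (a : Cyc_arc n) : Cyc_arc n := (a.1, ~~ a.2).
Definition Cyc_tail (n : nat) (a : Cyc_arc n) : 'Z_n :=
  if a.2 then (a.1 + 1)%R else a.1.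
Definition Cycgraph (n : nat) : agraph :=
  @AGraph (Cyc_arc n) ('Z_n : finType) (@Cyc_rev n) (@Cyc_tail n).

Definition aug_PX_map (p r : nat) (D : finType) (M : omap D) : Prop :=
  (exists s : nat, graph_iso M (PXgraph p r s)) \/ graph_iso M (Cycgraph (p * r)).

(* G is isomorphic to Z_p^d ><|_psi D_{2r} with psi irreducible over F_p:   *)
(* G = N ><| H with N elementary abelian p-group (N ~ F_p^d, d >= 1),       *)
(* H ~ D_{2r}, and the representation psi of H on N ~ F_p^d given by        *)
(* conjugation is irreducible.                                              *)
Definition irr_semidirect_dihedral (p r : nat) (gT : finGroupType)
    (G : {group gT}) : Prop :=
  exists (N H : {group gT}),
    [/\ N ><| H = G,
        H \isog 'D_(r.*2) &
        exists (abelN : p.-abelem N) (ntN : N :!=: 1) (nNH : H \subset 'N(N)),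
          mx_irreducible (abelem_repr abelN ntN nNH)].

Definition irr_rotary_aug_PX_map (p r : nat) (D : finType) (M : omap D) : Prop :=
  [/\ is_map M, rotary M, aug_PX_map p r M & irr_semidirect_dihedral p r (autp M)].

Definition num_irr_rotary_aug_PX_maps (p r k : nat) : Prop :=
  exists (Ds : 'I_k -> finType) (Ms : forall i, omap (Ds i)),
    [/\ forall i, irr_rotary_aug_PX_map p r (Ms i),
        forall i j, map_iso (Ms i) (Ms j) -> i = j &
        forall (D : finType) (M : omap D),
          irr_rotary_aug_PX_map p r M -> exists i, map_iso M (Ms i)].

(* Main.v *)
(* A rotary map is a group G with generators a (rotation at a vertex) and z (an
   involution), up to automorphisms of G and a -> a^-1.  Let G = N ><| D_2r with N
   irreducible.  If a has order 2p, put u = a^p and v = a^(p+1): then v lies in N and is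
   fixed by u, and (u z)^r = 1, for otherwise it would span N and be inverted by u.
   Hence (u, z) generate a complement and the map is determined by the representation
   of D_2r = <x, y> on N together with a nonzero vector v fixed by x.  Such a v is cyclic
   for the rotation A = xy, which makes it unique up to End_D2r(N), and the functional
   dual to the last vector of its Krylov basis provides the Praeger-Xu coordinates.
   If a has order 2, then G is dihedral of order 2pr and x, y both act as -1.
   An irreducible representation without x-fixed vectors has x = -1 and y = 1 or -1;
   only x = -1, y = 1, which exists exactly for even r, supports no map. *)

Require Import Defs.
From HB Require Import structures.
From mathcomp Require Import all_boot all_order all_algebra all_fingroup all_solvable.
From mathcomp Require Import mxrepresentation mxabelem.

Set Implicit Arguments.
Unset Strict Implicit.
Unset Printing Implicit Defensive.

Import Defs GroupScope GRing.Theory.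

(** Representations are counted, and not their classes under automorphisms of the dihedral group,
    because a map carries its generators: the complement is generated by a marked pair of
    involutions, and isomorphic maps must match these pairs. The orders 2p and 2 of a are the
    valencies of the augmented PX graphs, found by dividing the number of arcs by the number of
    vertices. Since p is odd and does not divide r, N is the Sylow p-subgroup of G, so a group
    isomorphism preserves N and is linear on it. Reflecting a map replaces a by its inverse, which
    leaves the involution a^p unchanged; hence mirror images give the same representation. If N has
    dimension n, a map of valency 2p has r p^(n-1) vertices, which forces s = n - 1: a dart needs n
    coordinates and a vertex forgets one of them, so what is required is a functional whose
    translates by n - 1 consecutive powers of the rotation vanish together exactly on the line of
    v. *)

(** * Maps given by a generating pair of a group *)

Section RegularMaps.

Variable gT : finGroupType.
Implicit Types a z x : gT.

Definition regmap a z : omap gT := OMap (actperm 'R%act a) (actperm 'R%act z).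

Lemma regmap_RE a z x : mR (regmap a z) x = x * a.
Proof. by rewrite actpermE. Qed.

Lemma regmap_LE a z x : mL (regmap a z) x = x * z.
Proof. by rewrite actpermE. Qed.

Lemma actpermR_inj : 'injm (actperm ('R : {action gT &-> gT})).
Proof.
apply/subsetP=> g /morphpreP[_ /set1P/permP/(_ 1)].
by rewrite actpermE perm1 /= mul1g => ->; apply: set11.
Qed.

Lemma mon_regmapE a z :
  mon (regmap a z) = actperm ('R : {action gT &-> gT}) @* <<[set a; z]>> :> {set _}.
Proof.
by rewrite morphim_gen ?subsetT // morphimU !morphim_set1 ?inE.
Qed.

Lemma mon_regmap_isog a z :
  <<[set a; z]>> = setT -> [set: gT] \isog mon (regmap a z).
Proof.
move=> gen; rewrite mon_regmapE gen.
exact: (sub_isog (subxx _) actpermR_inj).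
Qed.

Lemma porbit_regmap a z x y :
  (y \in porbit (mR (regmap a z)) x) = (x^-1 * y \in <[a]>).
Proof.
apply/porbitP/cycleP => [[i ->]|[i xy]]; exists i.
  elim: i => [|i IH]; first by rewrite !expg0 perm1 mulVg.
  by rewrite !expgSr permM regmap_RE mulgA IH.
have -> : y = x * a ^+ i by rewrite -xy mulKVg.
elim: i {xy} => [|i IH]; first by rewrite !expg0 perm1 mulg1.
by rewrite !expgSr permM regmap_RE mulgA IH.
Qed.

Lemma regmap_is_map a z :
  <<[set a; z]>> = setT -> z ^+ 2 = 1 -> z \notin <[a]> -> is_map (regmap a z).
Proof.
move=> gen z2 za; split=> [x|x||x].
- by rewrite !regmap_LE -mulgA -expg2 z2 mulg1.
- rewrite regmap_LE; apply: contra za => /eqP xz.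
  by rewrite -(mulKg x z) xz mulVg group1.
- apply/imsetP; exists 1; rewrite ?inE //; apply/setP=> x; rewrite inE.
  apply/esym/orbitP; exists (actperm 'R%act x); last first.
    by rewrite /= apermE actpermE /= mul1g.
  by rewrite mon_regmapE gen mem_morphim ?inE.
- by rewrite porbit_regmap regmap_LE mulKg.
Qed.

Lemma regmap_rotary a z : rotary (regmap a z).
Proof.
apply/imsetP; exists 1; rewrite ?inE //; apply/setP=> x; rewrite inE.
apply/esym/orbitP.
have inj : injective (fun y => x * y) by apply: mulgI.
exists (perm inj); last by rewrite /= apermE permE mulg1.
rewrite /autp /= cent_gen; apply/centP=> t /set2P[] ->; apply/permP=> y;
  by rewrite !permM !permE /= ?actpermE /= ?permE mulgA.
Qed.

End RegularMaps.

(** Left translations are automorphisms of the target map, so an isomorphism may be normalised to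
    send 1 to 1. Commuting with right multiplication by the generators then makes it multiplicative.
    The orientation survives only as the choice between [b] and [b^-1]. *)
Lemma regmap_iso_morphism (gT hT : finGroupType) (a z : gT) (b t : hT) :
    <<[set a; z]>> = setT -> map_iso (regmap a z) (regmap b t) ->
  exists f : {morphism [set: gT] >-> hT},
    [/\ 'injm f, f @* setT = setT, f z = t & f a = b \/ f a = b^-1].
Proof.
move=> gen [f [[f' fK f'K] fL fR]].
have {}fL x : f (x * z) = f x * t by move: (fL x); rewrite !regmap_LE.
have [c cE fR'] : exists2 c, c = b \/ c = b^-1 & forall x, f (x * a) = f x * c.
  case: fR => fR; [exists b|exists b^-1]; try by [left|right].
    by move=> x; move: (fR x); rewrite !regmap_RE.
  move=> x; move: (fR x); rewrite regmap_RE => ->.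
  by apply: (@perm_inj _ (mR (regmap b t))); rewrite permKV regmap_RE mulgKV.
pose g x := (f 1)^-1 * f x.
have fM : {in setT &, {morph g : x y / x * y}}.
  move=> x y _ _; have : y \in <<[set a; z]>> by rewrite gen inE.
  move=> /gen_prodgP[n [c' c'P ->]].
  elim: n c' c'P => [|n IH] c' c'P.
    by rewrite big_ord0 mulg1 /g mulVg mulg1.
  rewrite big_ord_recr /=.
  have {}IH := IH _ (fun i => c'P (widen_ord (leqnSn n) i)).
  set w := \prod_(i < n) _ in IH *.
  by case/set2P: (c'P ord_max) => ->; rewrite /g !mulgA ?fL ?fR' !mulgA;
    move: IH; rewrite /g !mulgA => ->.
exists (Morphism fM); split.
- apply/injmP=> x y _ _ /= /mulgI; exact: (can_inj fK).
- apply/setP=> y; rewrite !inE; apply/morphimP; exists (f' (f 1 * y)); rewrite ?inE //=.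
  by rewrite /g f'K mulKg.
- by rewrite /= /g -[z]mul1g fL mulKg.
- by rewrite /= /g -[a]mul1g fR' mulKg.
Qed.

(** * The two regular groups of a rotary map, and counting its darts *)

Section RotaryMaps.

Variables (D : finType) (M : omap D).
Hypotheses (mapM : is_map M) (rotM : rotary M).

Lemma mon_transP x y : exists2 m, m \in mon M & m x = y.
Proof.
case: mapM => _ _ tr _.
have : y \in orbit 'P (mon M) x by rewrite (atransP tr) ?inE.
by case/orbitP=> m Mm /=; rewrite apermE => <-; exists m.
Qed.

Lemma autp_transP x y : exists2 m, m \in autp M & m x = y.
Proof.
have : y \in orbit 'P (autp M) x by rewrite (atransP rotM) ?inE.
by case/orbitP=> m Mm /=; rewrite apermE => <-; exists m.
Qed.

Lemma autp_comm c m x : c \in autp M -> m \in mon M -> c (m x) = m (c x).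
Proof. by move=> /centP cM /cM; rewrite /commute -!permM => ->. Qed.

Lemma mon_free m x : m \in mon M -> m x = x -> m = 1.
Proof.
move=> Mm mx; apply/permP=> y; rewrite perm1.
by have [c Cc <-] := autp_transP x y; rewrite -autp_comm // mx.
Qed.

Lemma autp_free c x : c \in autp M -> c x = x -> c = 1.
Proof.
move=> Cc cx; apply/permP=> y; rewrite perm1.
by have [m Mm <-] := mon_transP x y; rewrite autp_comm // cx.
Qed.

Lemma mon_inj x : {in mon M &, injective (fun m : {perm D} => m x)}.
Proof.
move=> m1 m2 M1 M2 /= e; apply/eqP; rewrite eq_mulgV1; apply/eqP.
by apply: (@mon_free _ x); rewrite ?groupM ?groupV // permM e permK.
Qed.

Lemma card_mon (x : D) : #|mon M| = #|D|.
Proof.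
rewrite -(card_in_imset (@mon_inj x)) -cardsT; congr #|pred_of_set _|.
apply/setP=> y; rewrite inE; apply/imsetP.
by have [m Mm <-] := mon_transP x y; exists m.
Qed.

Lemma map_dart : D.
Proof.
case: mapM => _ _ tr _; case: (pickP (@predT D)) => [x _|no]; first exact: x.
by exfalso; case/imsetP: tr => x; rewrite !inE; move: (no x).
Qed.

(* Both groups act regularly, and fixing a base dart x0 turns them into the
   left and right translations of one group. *)
Lemma autp_isog_mon : autp M \isog mon M.
Proof.
pose x0 := map_dart.
(* [tau c] brings [c x0] back to [x0]. Carrying [x0] to [c x0] instead would give an
   antihomomorphism, because the two actions commute. *)
pose tau (c : {perm D}) : {perm D} := odflt 1 [pick m in mon M | m (c x0) == x0].
have tauP c : tau c \in mon M /\ tau c (c x0) = x0.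
  rewrite /tau; case: pickP => [m /andP[-> /eqP] //|no].
  have [m Mm mx] := mon_transP (c x0) x0.
  by move: (no m); rewrite /= Mm mx eqxx.
have tauM : {in autp M &, {morph tau : c d / c * d}}.
  move=> c d Cc Cd; have [Mc cx] := tauP c; have [Md dx] := tauP d.
  have [Mcd cdx] := tauP (c * d).
  apply: (@mon_inj ((c * d) x0)); rewrite ?groupM //=.
  by rewrite cdx !permM -(autp_comm _ Cd Mc) cx dx.
apply/isogP; exists (Morphism tauM) => /=.
  apply/injmP=> c d Cc Cd /= e; have [_ cx] := tauP c; have [_ dx] := tauP d.
  apply/eqP; rewrite eq_mulgV1; apply/eqP; apply: (@autp_free _ x0).
    by rewrite groupM ?groupV.
  have /perm_inj : tau c (c x0) = tau c (d x0) by rewrite cx e dx.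
  by rewrite permM => ->; rewrite permK.
apply/setP=> m; apply/morphimP/idP => [[c _ _ ->]|Mm]; first by case: (tauP c).
have [c Cc cx] := autp_transP x0 (m^-1 x0).
exists c => //=; have [Mc cx'] := tauP c.
by apply: (@mon_inj (c x0)) => //=; rewrite cx' cx permKV.
Qed.

Lemma mon_morphism_map_iso (gT : finGroupType) (a z : gT)
    (f : {morphism [set: gT] >-> {perm D}}) :
    'injm f -> f @* setT = mon M -> f a = mR M -> f z = mL M ->
  map_iso M (regmap a z).
Proof.
move=> injf imf fa fz; pose x0 := map_dart.
pose g t := f t x0.
have Mf t : f t \in mon M by rewrite -imf mem_morphim ?inE.
have g_bij : bijective g.
  apply: inj_card_bij => [t1 t2 e|].
    by apply: (injmP injf); rewrite ?inE //; exact: (mon_inj (Mf t1) (Mf t2) e).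
  by rewrite -(card_mon x0) -imf card_injm ?cardsT ?subsetT.
case: g_bij => g' gK g'K.
have morf t1 t2 : f (t1 * t2) = f t1 * f t2 by rewrite morphM ?inE.
exists g'; split; first by exists g.
  move=> x; apply: (can_inj gK); rewrite g'K regmap_LE /g morf permM fz.
  by rewrite -/(g _) g'K.
left=> x; apply: (can_inj gK); rewrite g'K regmap_RE /g morf permM fa.
by rewrite -/(g _) g'K.
Qed.

Lemma card_porbit_mR x : #|porbit (mR M) x| = #[mR M].
Proof.
have sub : <[mR M]> \subset mon M by rewrite cycle_subG mem_gen ?inE ?eqxx.
rewrite porbitE card_in_imset // => m1 m2 /(subsetP sub) M1 /(subsetP sub) M2.
by rewrite /= !apermE => /(mon_inj M1 M2).
Qed.

(** Darts are counted by their tails: each fibre is one cycle of the rotation, and freeness of the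
    monodromy group gives all cycles the same length. The shape of the graph thus determines the
    order of [mR M]. *)
Lemma graph_iso_counts Gam : graph_iso M Gam ->
  #|D| = #|arc Gam| /\ #|arc Gam| = (#|vert Gam| * #[mR M])%N.
Proof.
case=> f [bijf fL ft surj].
have cD : #|D| = #|arc Gam| := bij_eq_card bijf.
split=> //; rewrite -cD -sum1_card.
rewrite (partition_big (fun x => atail (f x)) predT) //= -sum_nat_const.
apply: eq_bigr => v _; have [a av] := surj v.
case: bijf => f' fK f'K.
rewrite -(card_porbit_mR (f' a)) sum1_card; apply: eq_card => x.
by rewrite unfold_in -ft f'K av eq_sym.
Qed.

End RotaryMaps.

(** * Pairs of involutions and dihedral groups *)

Section InvolutionPairs.

Variables (gT : finGroupType) (x y : gT).
Hypotheses (x2 : x ^+ 2 = 1) (y2 : y ^+ 2 = 1).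

Lemma involV (u : gT) : u ^+ 2 = 1 -> u^-1 = u.
Proof. by rewrite expg2 => /(canRL (mulgK _)); rewrite mul1g => <-. Qed.

Lemma invol_prodV : (x * y)^-1 = y * x.
Proof. by rewrite invMg !involV. Qed.

Lemma invol_prodJl i : ((x * y) ^+ i) ^ x = (x * y) ^- i.
Proof.
rewrite conjXg conjgE (involV x2) !mulgA -expg2 x2 mul1g.
by rewrite -invol_prodV expgVn.
Qed.

Lemma invol_prodJr i : ((x * y) ^+ i) ^ y = (x * y) ^- i.
Proof.
rewrite conjXg conjgE (involV y2) !mulgA -[_ * y * y]mulgA -expg2 y2 mulg1.
by rewrite -invol_prodV expgVn.
Qed.

Lemma card_gen_invol : #|<<[set x; y]>>| <= #[x * y].*2.
Proof.
have -> : <<[set x; y]>> = <[x * y]> * <[x]>.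
  rewrite -norm_joinEr; last first.
    rewrite cycle_subG; apply/normP; rewrite -cycleJ.
    by have := invol_prodJl 1; rewrite expg1 => ->; rewrite cycleV.
  have jx : x \in <[x * y]> <*> <[x]> by rewrite mem_gen // inE cycle_id orbT.
  have jxy : x * y \in <[x * y]> <*> <[x]> by rewrite mem_gen // inE cycle_id.
  have gx : x \in <<[set x; y]>> by rewrite mem_gen // !inE eqxx.
  have gy : y \in <<[set x; y]>> by rewrite mem_gen // !inE eqxx orbT.
  apply/eqP; rewrite eqEsubset gen_subG subUset !sub1set join_subG !cycle_subG.
  by rewrite jx gx (groupM gx gy) /= !andbT -[y](mulKg x) groupM ?groupV ?mulKg.
rewrite (leq_trans (dvdn_leq _ (dvdn_cardMg _ _))) ?muln_gt0 ?cardG_gt0 //.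
rewrite -muln2 leq_pmul2l ?order_gt0 // dvdn_leq // -orderE order_dvdn.
exact/eqP.
Qed.

(* A commuting pair of involutions generates at most a four-group. *)
Lemma invol_pair_noncomm r :
  2 < r -> #|<<[set x; y]>>| = r.*2 -> x * y != y * x.
Proof.
move=> r3 cG; apply/eqP=> xy; move: card_gen_invol; rewrite cG leq_double.
have o2 : #[x * y] <= 2.
  by rewrite dvdn_leq // order_dvdn expgMn // x2 y2 mulg1.
by move=> /leq_trans/(_ o2); rewrite leqNgt r3.
Qed.

(** By [card_gen_invol] the rotation subgroup has index at most 2, and index 1 would make the whole
    group cyclic. *)
Lemma invol_prod_order r :
    #|<<[set x; y]>>| = r.*2 -> ~~ abelian <<[set x; y]>> -> (x * y) ^+ r = 1.
Proof.
move=> cG nab; apply/eqP; rewrite -order_dvdn.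
have sub : <[x * y]> \subset <<[set x; y]>>.
  by rewrite cycle_subG groupM ?mem_gen ?inE ?eqxx ?orbT.
have [k ck] := dvdnP (cardSg sub); move: card_gen_invol ck; rewrite cG -orderE => le ck.
case: k ck => [|[|k]] ck.
- by have := cardG_gt0 <<[set x; y]>>; rewrite cG ck mul0n.
- case/negP: nab; suff -> : <<[set x; y]>> = <[x * y]> by apply: cycle_abelian.
  by apply/eqP; rewrite eq_sym eqEcard sub cG ck mul1n -orderE leqnn.
case: k ck => [|k] ck; first by rewrite mul2n in ck; rewrite (double_inj ck).
move: le; rewrite ck -mul2n leq_pmul2r ?order_gt0 //.
Qed.

End InvolutionPairs.

(* The subgroup of the product generated by the pairs (x, u) and (y, z) is the
   graph of the morphism: it is too small not to be one. *)
Lemma invol_pair_morphism (gT rT : finGroupType) (x y : gT) (u z : rT) r :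
    <<[set x; y]>> = setT -> #|gT| = r.*2 ->
    x ^+ 2 = 1 -> y ^+ 2 = 1 -> (x * y) ^+ r = 1 ->
    u ^+ 2 = 1 -> z ^+ 2 = 1 -> (u * z) ^+ r = 1 ->
  exists f : {morphism [set: gT] >-> rT}, f x = u /\ f y = z.
Proof.
move=> gen cG x2 y2 xyr u2 z2 uzr.
pose X : gT * rT := (x, u); pose Y : gT * rT := (y, z).
pose K := <<[set X; Y]>>%G.
have expX (A : gT * rT) i : A ^+ i = (A.1 ^+ i, A.2 ^+ i).
  elim: i => [|i IH]; first by rewrite !expg0.
  by rewrite expgS IH (expgS A.1) (expgS A.2).
have cK : #|K| <= r.*2.
  apply: leq_trans (card_gen_invol _ _) _; rewrite ?expX /= ?x2 ?u2 ?y2 ?z2 //.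
  rewrite leq_double dvdn_leq //; last by rewrite order_dvdn expX /= xyr uzr.
  by rewrite -double_gt0 -cG; apply/card_gt0P; exists 1.
have sK : K \subset [set: gT * rT] by rewrite subsetT.
pose g := restrm_morphism sK (fst_morphism gT rT).
have KX : X \in K by rewrite mem_gen ?inE ?eqxx.
have KY : Y \in K by rewrite mem_gen ?inE ?eqxx ?orbT.
have img : g @* K = setT.
  apply/eqP; rewrite -subTset -gen gen_subG subUset !sub1set.
  by rewrite (mem_morphim g KX KX) (mem_morphim g KY KY).
have injg : 'injm g.
  by rewrite -card_im_injm img eqn_leq cardsT cG cK andbT -cG -cardsT -img leq_morphim.
pose f (t : gT) := (invm injg t).2.
have domf t : t \in g @* K by rewrite img inE.
have fM : {in setT &, {morph f : s t / s * t}}.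
  by move=> s t _ _; rewrite /f morphM ?domf.
exists (Morphism fM); split.
  by rewrite /= /f (_ : x = g X) // invmE.
by rewrite /= /f (_ : y = g Y) // invmE.
Qed.

Lemma dihedral_gens r : 1 < r -> exists x y : 'D_(r.*2),
  [/\ x ^+ 2 = 1, y ^+ 2 = 1, (x * y) ^+ r = 1 & <<[set x; y]>> = setT].
Proof.
move=> r1; have := homg_refl [set: 'D_(r.*2)]; rewrite (Grp'_dihedral r1).
case/existsP=> [[x y]] /=; rewrite !xpair_eqE /= => /and4P[/eqP g /eqP x2 /eqP y2 /eqP xy].
by exists x, y; split=> //; rewrite -g joing_idl joing_idr.
Qed.

Lemma dihedral_nonabelian r : 2 < r -> ~~ abelian [set: 'D_(r.*2)].
Proof.
move=> r3; have [x [y [x2 y2 xyr gen]]] := dihedral_gens (ltnW r3).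
have /eqP nc : x * y != y * x.
  by apply: (invol_pair_noncomm x2 y2 r3); rewrite gen card_dihedral // ltnW.
by apply/negP=> /centsP ab; apply: nc; apply: ab; rewrite inE.
Qed.

(** * Complements adapted to the generators of a map *)

Section Complements.

Variables (gT : finGroupType) (P N : {group gT}) (p r : nat).
Hypotheses (p_pr : prime p) (p_odd : odd p) (r3 : 2 < r) (pr : ~~ (p %| r)).

Let r_gt0 : 0 < r. Proof. exact: ltn_trans r3. Qed.

(** An abelian N centralises its own subgroups, so which of them are normalised depends only on the
    product N H. This allows the given complement to be exchanged for one built from the map. *)
Lemma minnormal_complement (H Q : {group gT}) :
  minnormal N H -> abelian N -> N * H = N * Q -> Q \subset 'N(N) -> minnormal N Q.
Proof.
move=> /mingroupP[/andP[ntN nNH] minN] abN eNQ nNQ.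
apply/mingroupP; split=> [|K /andP[ntK nKQ] sKN]; first by rewrite ntN.
apply: minN => //; rewrite ntK /=.
have sH : H \subset N * Q by rewrite -eNQ mulG_subr.
apply: subset_trans sH _; rewrite mul_subG //.
exact: subset_trans (sub_abelian_cent abN sKN) (cent_sub K).
Qed.

(** A squeeze on orders: the relation (u y)^r = 1 bounds the dihedral subgroup by 2r, while covering
    P modulo N needs at least 2r elements. The intersection with N is therefore trivial. *)
Lemma invol_pair_complement (u y : gT) :
    N <| P -> #|P| = (#|N| * r.*2)%N -> u ^+ 2 = 1 -> y ^+ 2 = 1 ->
    (u * y) ^+ r = 1 -> u \in P -> y \in P -> P \subset N * <<[set u; y]>> ->
  N ><| <<[set u; y]>> = P /\ #|<<[set u; y]>>| = r.*2.
Proof.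
case/andP=> sNP nNP cP u2 y2 uyr Pu Py sP.
have sQP : <<[set u; y]>> \subset P by rewrite gen_subG subUset !sub1set Pu.
have eP : N * <<[set u; y]>> = P.
  by apply/eqP; rewrite eqEsubset sP mul_subG.
have leQ : #|<<[set u; y]>>| <= r.*2.
  apply: leq_trans (card_gen_invol u2 y2) _; rewrite leq_double dvdn_leq //.
  by rewrite order_dvdn uyr.
have := mul_cardG N <<[set u; y]>>; rewrite eP cP -mulnA => /eqP.
rewrite eqn_pmul2l ?cardG_gt0 // => /eqP cQ.
have cQ' : #|<<[set u; y]>>| = r.*2.
  by apply/eqP; rewrite eqn_leq leQ cQ leq_pmulr ?cardG_gt0.
split=> //; rewrite sdprodE ?(subset_trans sQP) //.
apply/trivgP; rewrite subG1 trivg_card1 -(eqn_pmul2l (_ : 0 < r.*2)) ?double_gt0 //.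
by rewrite -cQ muln1 cQ'.
Qed.

Section Classification.

Variables (H : {group gT}) (a z : gT).
Hypotheses (sdP : N ><| H = P) (isoH : H \isog 'D_(r.*2)).
Hypotheses (abelN : p.-abelem N) (minN : minnormal N H).
Hypotheses (genP : <<[set a; z]>> = P) (z2 : z ^+ 2 = 1).

Let nNP : N <| P. Proof. by case/sdprod_context: sdP. Qed.
Let cH : #|H| = r.*2.
Proof. by rewrite (card_isog isoH) card_dihedral // ltnW. Qed.
Let cP : #|P| = (#|N| * r.*2)%N.
Proof. by rewrite -(sdprod_card sdP) cH. Qed.
Let Pa : a \in P. Proof. by rewrite -genP mem_gen ?inE ?eqxx. Qed.
Let Pz : z \in P. Proof. by rewrite -genP mem_gen ?inE ?eqxx ?orbT. Qed.

Let hallN : p.-Hall(P) N.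
Proof.
have r0 : 0 < r.*2 by rewrite double_gt0 r_gt0.
rewrite pHallE (normal_sub nNP) /= cP partnM ?cardG_gt0 //.
rewrite (part_pnat_id (abelem_pgroup abelN)) part_p'nat ?muln1 //.
rewrite p'natE //; apply: contra pr; rewrite -muln2 Euclid_dvdM // => /orP[//|].
move=> /(dvdn_leq (isT : 0 < 2)) p2.
by move: p_odd; rewrite (_ : p = 2) //; apply/eqP; rewrite eqn_leq p2 prime_gt1.
Qed.

(** Here [u] is an involution in the coset of [a]. Modulo N the pair (u, z) generates a copy of the
    dihedral group, to which [invol_prod_order] applies. *)
Let quo_order (u : gT) : u \in P -> u ^+ 2 = 1 -> a * u^-1 \in N -> (u * z) ^+ r \in N.
Proof.
move=> Pu u2 au.
have nNu := subsetP (normal_norm nNP) u Pu; have nNz := subsetP (normal_norm nNP) z Pz.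
have nNa := subsetP (normal_norm nNP) a Pa.
have isoQ : H \isog P / N by apply: sdprod_isog.
have eQ : P / N = <<[set coset N u; coset N z]>>.
  rewrite -genP quotient_gen ?subUset ?sub1set ?nNa // /quotient morphimU.
  rewrite !morphim_set1 // ; congr <<[set _; _]>>.
  apply/eqP; rewrite eq_mulgV1 -morphV // -morphM ?groupV //.
  by rewrite /= coset_id.
have e1 : coset N ((u * z) ^+ r) = 1.
  rewrite morphX ?groupM // morphM //.
  apply: (@invol_prod_order _ _ _ _ _ r).
  - by rewrite -morphX // u2 morph1.
  - by rewrite -morphX // z2 morph1.
  - by rewrite -eQ -(card_isog isoQ).
  - rewrite -eQ -(isog_abelian isoQ) (isog_abelian isoH).
    exact: dihedral_nonabelian.
by apply: coset_idr e1; rewrite groupX ?groupM.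
Qed.

Lemma frame_2p : #[a] = p.*2 -> let u := a ^+ p in let v := a ^+ p.+1 in
  [/\ [/\ u ^+ 2 = 1, (u * z) ^+ r = 1 & N ><| <<[set u; z]>> = P],
      minnormal N <<[set u; z]>>,
      #|<<[set u; z]>>| = r.*2 & [/\ v \in N, v != 1, v ^ u = v & a = v * u]].
Proof.
move=> oa u v.
have a2p : a ^+ p.*2 = 1 by rewrite -oa expg_order.
have u2 : u ^+ 2 = 1 by rewrite /u -expgM muln2.
(* The exponents p + 1 and p split [a] into commuting p-part and 2-part: 2p divides p (p + 1)
   because p + 1 is even, and (p + 1) + p = 2p + 1 gives a = v u. *)
have vp : v ^+ p = 1.
  rewrite /v -expgM (_ : p.+1 * p = p.*2 * p.+1./2)%N; last first.
    by rewrite -doubleMl doubleMr even_halfK 1?mulnC //= p_odd.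
  by rewrite expgM a2p expg1n.
have Pu : u \in P by rewrite groupX.
have Pv : v \in P by rewrite groupX.
have avu : a = v * u by rewrite /v /u -expgD addSn addnn expgSr a2p mul1g.
have Nv : v \in N.
  rewrite (mem_normal_Hall hallN nNP) //; apply: (pnat_dvd (_ : #[v] %| p)).
    by rewrite order_dvdn vp.
  exact: pnat_id.
have v1 : v != 1.
  rewrite -order_dvdn oa; apply/negP=> /(dvdn_leq (isT : 0 < p.+1)).
  by rewrite -addnn -[p.+1]addn1 leq_add2l leqNgt prime_gt1.
have vu : v ^ u = v.
  by rewrite conjgE (_ : v * u = u * v) ?mulKg //; apply: commuteX2.
have tN : (u * z) ^+ r \in N.
  by apply: quo_order => //; rewrite avu mulgK.
have abN := abelem_abelian abelN.
have t1 : (u * z) ^+ r = 1.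
  (* Both [u] and [z] invert [t], and [v] centralises it, so [<[t]>] is normal in P and equals N by
     minimality. Then [v] would be fixed and inverted by [u] at once, which is impossible in odd
     order p. *)
  set t := (u * z) ^+ r in tN *; apply/eqP/negP=> /negP nt.
  have tu : t ^ u = t^-1 by apply: invol_prodJl.
  have tz : t ^ z = t^-1 by apply: invol_prodJr.
  have tv : t ^ v = t by rewrite conjgE (centsP abN _ tN _ Nv) mulKg.
  have nP : P \subset 'N(<[t]>).
    rewrite -genP gen_subG subUset !sub1set avu groupM //;
      by apply/normP; rewrite -cycleJ ?tu ?tz ?tv ?cycleV.
  case/mingroupP: minN => _ /(_ <[t]>%G) m.
  have eN : <[t]> = N.
    apply: m; last by rewrite cycle_subG.
    rewrite cycle_eq1 nt /= (subset_trans _ nP) //.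
    by case/sdprod_context: sdP.
  move: Nv; rewrite -eN => /cycleP[i vi].
  have vV : v^-1 = v by rewrite -[RHS]vu {2}vi conjXg tu expgVn -vi.
  have v2 : v ^+ 2 = 1 by rewrite expg2 -{1}vV mulVg.
  case/negP: v1; rewrite -(expg1 v) -(eqP (_ : coprime p 2)).
    by rewrite -order_dvdn dvdn_gcd !order_dvdn vp v2 eqxx.
  by rewrite coprimen2.
have sP : P \subset N * <<[set u; z]>>.
  rewrite -norm_joinEr.
    have jv := subsetP (joing_subl N <<[set u; z]>>) v Nv.
    have /subsetP ju := joing_subr N <<[set u; z]>>.
    rewrite -{1}genP gen_subG subUset !sub1set avu (groupM jv) /=; last first.
      by apply: ju; rewrite mem_gen ?inE ?eqxx.
    by apply: ju; rewrite mem_gen ?inE ?eqxx ?orbT.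
  by rewrite gen_subG subUset !sub1set !(subsetP (normal_norm nNP)).
have [sd cQ] := invol_pair_complement nNP cP u2 z2 t1 Pu Pz sP.
split=> //; apply: (minnormal_complement minN abN).
  by case/sdprodP: sd => _ -> _ _; case/sdprodP: sdP.
by case/sdprodP: sd.
Qed.

(* Here P is dihedral of order 2pr; the generator z is moved into a complement of
   N = <c^r> by a Chinese remainder correction. *)
Lemma frame_2 : #[a] = 2 -> #|N| = p -> exists y w,
  [/\ [/\ a ^+ 2 = 1, y ^+ 2 = 1, (a * y) ^+ r = 1 & N ><| <<[set a; y]>> = P],
      minnormal N <<[set a; y]>>,
      #|<<[set a; y]>>| = r.*2 & [/\ w \in N, w != 1, z = w * y & w ^ a = w^-1 /\ w ^ y = w^-1]].
Proof.
move=> oa cN.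
have a2 : a ^+ 2 = 1 by rewrite -oa expg_order.
pose c := a * z.
have cr : c ^+ r \in N by apply: quo_order; rewrite ?mulgV.
have cpr : c ^+ (r * p) = 1.
  by rewrite expgM -cN; apply/eqP; rewrite -order_dvdn order_dvdG.
have ord_c : #[c] = (r * p)%N.
  apply/eqP; rewrite eqn_leq dvdn_leq ?order_dvdn ?cpr ?muln_gt0 ?r_gt0 ?(prime_gt0 p_pr) //=.
  by rewrite -leq_double doubleMl mulnC -cN -cP -genP card_gen_invol.
have co : coprime r p by rewrite coprime_sym prime_coprime.
(* Since e = 1 mod r, the element y = a c^e agrees with z = a c modulo [<[c ^+ r]>], hence modulo N.
   Since p divides e, the product a y = c^e has trivial r-th power. *)
pose e := chinese r p 1 0.
have er : e = 1 %[mod r] by apply: chinese_modl.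
have ep : p %| e by rewrite /dvdn (chinese_modr co) mod0n.
have e0 : 0 < e by case: (e) er => // /eqP; rewrite mod0n modn_small // ltnW.
pose y := a * c ^+ e; pose w := c ^+ e.-1.
have cJ i : c ^+ i ^ a = c ^- i by apply: invol_prodJl.
have y2 : y ^+ 2 = 1.
  by rewrite expg2 /y mulgA -(mulgA a) (conjgC (c ^+ e)) cJ mulgA -(expg2 a) a2 mul1g mulVg.
have ay : a * y = c ^+ e by rewrite /y mulgA -expg2 a2 mul1g.
have zE : z = w * y.
  rewrite /w /y mulgA (conjgC (c ^+ _)) cJ -mulgA -{2}(prednK e0) expgSr mulKg.
  by rewrite /c mulgA -expg2 a2 mul1g.
have re : r %| e.-1 by rewrite -subn1 -eqn_mod_dvd //; apply/eqP.
have Nw : w \in N by rewrite /w -(divnK re) mulnC expgM groupX.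
have w1 : w != 1.
  rewrite /w -order_dvdn ord_c; apply/negP=> /(dvdn_trans (dvdn_mull r (dvdnn p))).
  move=> pe; have := ep; rewrite -(prednK e0) -addn1 dvdn_addr // dvdn1.
  by move/eqP=> p1; move: p_pr; rewrite p1.
have wa : w ^ a = w^-1 by apply: cJ.
have wy : w ^ y = w^-1.
  rewrite /y conjgM wa conjVg; congr (_^-1).
  by rewrite conjgE (_ : w * _ = c ^+ e * w) ?mulKg //; apply: commuteX2.
have ayr : (a * y) ^+ r = 1.
  by rewrite ay -expgM; apply/eqP; rewrite -order_dvdn ord_c mulnC dvdn_pmul2r.
have Py : y \in P by rewrite !(groupM, groupX).
have sP : P \subset N * <<[set a; y]>>.
  rewrite -norm_joinEr.
    have jw := subsetP (joing_subl N <<[set a; y]>>) w Nw.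
    have /subsetP ja := joing_subr N <<[set a; y]>>.
    rewrite -{1}genP gen_subG subUset !sub1set zE (groupM jw) ?andbT; last first.
      by apply: ja; rewrite mem_gen ?inE ?eqxx ?orbT.
    by apply: ja; rewrite mem_gen ?inE ?eqxx.
  by rewrite gen_subG subUset !sub1set !(subsetP (normal_norm nNP)).
have [sd cQ] := invol_pair_complement nNP cP a2 y2 ayr Pa Py sP.
exists y, w; split=> //; apply: (minnormal_complement minN (abelem_abelian abelN)).
  by case/sdprodP: sd => _ -> _ _; case/sdprodP: sdP.
by case/sdprodP: sd.
Qed.

End Classification.

End Complements.

(** Irreducibility of the conjugation module is minimal normality of N under H, a condition free of
    modules that passes easily through isomorphisms and changes of complement. *)
Lemma irr_semidirectP p r (gT : finGroupType) (G : {group gT}) :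
  irr_semidirect_dihedral p r G <-> exists N H : {group gT},
    [/\ N ><| H = G, H \isog 'D_(r.*2), p.-abelem N & minnormal N H].
Proof.
split=> [[N [H [sd iso [abelN [ntN [nNH irr]]]]]]|[N [H [sd iso abelN minN]]]].
  by exists N, H; split=> //; apply/(abelem_mx_irrP abelN ntN nNH).
have /andP[ntN nNH] := mingroupp minN.
by exists N, H; split=> //; exists abelN, ntN, nNH; apply/abelem_mx_irrP.
Qed.

Lemma irr_semidirect_isog p r (gT hT : finGroupType)
    (G : {group gT}) (K : {group hT}) :
  G \isog K -> irr_semidirect_dihedral p r G -> irr_semidirect_dihedral p r K.
Proof.
case/isogP=> f injf imf /irr_semidirectP[N [H [sd iso abelN minN]]].
have [nNG sHG _ _ _] := sdprod_context sd; have sNG := normal_sub nNG.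
apply/irr_semidirectP; exists (f @* N)%G, (f @* H)%G; split.
- by rewrite -imf; apply: injm_sdprod.
- by apply: isog_trans _ iso; rewrite isog_sym sub_isog.
- by rewrite morphim_abelem.
- by rewrite injm_minnormal.
Qed.

(** * The split extension attached to a representation over F_p *)

Section Model.

Variables (p n : nat) (T : finGroupType).
Hypothesis p_pr : prime p.
Variable rho : mx_representation 'F_p [set: T]%G n.

Definition model : finGroupType := sdprod_groupType ('MR rho)%gact.
Definition nu (w : 'rV['F_p]_n) : model := sdpair1 ('MR rho)%gact w.
Definition eta (g : T) : model := sdpair2 ('MR rho)%gact g.

Lemma nuD v w : nu (v + w)%R = nu v * nu w.
Proof. by rewrite /nu -morphM ?inE. Qed.

Lemma nu0 : nu 0%R = 1.
Proof. exact: morph1. Qed.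

Lemma nuN w : nu (- w)%R = (nu w)^-1.
Proof. by apply/eqP; rewrite eq_sym eq_invg_mul -nuD addrN nu0. Qed.

Lemma nuX w i : nu w ^+ i = nu (w *+ i)%R.
Proof.
elim: i => [|i IH]; first by rewrite expg0 mulr0n nu0.
by rewrite expgS mulrS nuD IH.
Qed.

Lemma etaM g h : eta (g * h) = eta g * eta h.
Proof. by rewrite /eta -morphM ?inE. Qed.

Lemma eta1 : eta 1 = 1.
Proof. exact: morph1. Qed.

Lemma etaV g : eta g^-1 = (eta g)^-1.
Proof. by apply/eqP; rewrite eq_sym eq_invg_mul -etaM mulgV eta1. Qed.

Lemma etaX g i : eta (g ^+ i) = eta g ^+ i.
Proof.
elim: i => [|i IH]; first by rewrite !expg0 eta1.
by rewrite !expgS etaM IH.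
Qed.

Lemma nuJ w g : nu w ^ eta g = nu (w *m rho g)%R.
Proof. by rewrite /nu /eta -sdpair_act ?inE //= mx_repr_actE ?inE. Qed.

Lemma nu_inj : injective nu.
Proof. by move=> v w; apply: (injmP (injm_sdpair1 _)); rewrite inE. Qed.

Lemma eta_inj : injective eta.
Proof. by move=> v w; apply: (injmP (injm_sdpair2 _)); rewrite inE. Qed.

Definition Nmod : {group model} := (sdpair1 ('MR rho)%gact @* setT)%G.
Definition Hmod : {group model} := (sdpair2 ('MR rho)%gact @* setT)%G.

Lemma model_sdprod : Nmod ><| Hmod = setT.
Proof. exact: sdprod_sdpair. Qed.

Lemma mem_Nmod t : reflect (exists w, t = nu w) (t \in Nmod).
Proof.
by apply: (iffP morphimP) => [[w _ _ ->]|[w ->]]; exists w; rewrite ?inE.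
Qed.

Lemma mem_Hmod t : reflect (exists g, t = eta g) (t \in Hmod).
Proof.
by apply: (iffP morphimP) => [[w _ _ ->]|[w ->]]; exists w; rewrite ?inE.
Qed.

Lemma card_model : #|model| = (p ^ n * #|T|)%N.
Proof.
rewrite -cardsT -(sdprod_card model_sdprod).
rewrite !card_injm ?subsetT ?injm_sdpair1 ?injm_sdpair2 // !cardsT.
by rewrite card_mx mul1n card_Fp.
Qed.

Lemma nu_eta_inj v w g h : nu v * eta g = nu w * eta h -> v = w /\ g = h.
Proof.
move=> e.
have e2 : nu (v - w)%R = eta (h * g^-1).
  rewrite etaM etaV; apply: (canRL (mulgK _)).
  by rewrite addrC nuD nuN -mulgA e mulKg.
have : nu (v - w)%R \in Nmod :&: Hmod.
  by rewrite inE; apply/andP; split; [apply/mem_Nmod|apply/mem_Hmod]; eexists; eauto.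
case/sdprodP: model_sdprod => _ _ _ -> /set1P e3.
split; first by apply/eqP; rewrite -subr_eq0; apply/eqP/nu_inj; rewrite e3 nu0.
by apply/esym/eqP; rewrite eq_mulgV1; apply/eqP/eta_inj; rewrite -e2 e3 eta1.
Qed.

Lemma abelem_Nmod : p.-abelem Nmod.
Proof. by rewrite morphim_abelem // mx_Fp_abelem. Qed.

Lemma minnormal_model : mx_irreducible rho -> minnormal Nmod Hmod.
Proof.
case/mx_irrP=> n_gt0 irr; apply/mingroupP; split=> [|K /andP[ntK nKH] sKN].
  rewrite im_sdpair_norm andbT /= morphim_injm_eq1 ?injm_sdpair1 ?subsetT //.
  by rewrite -cardG_gt1 cardsT card_mx mul1n card_Fp // -(exp1n n) ltn_exp2r ?prime_gt1.
(* Over F_p every additive subgroup of the row space is a subspace. The preimage of K is thus the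
   row space of a matrix, and [nKH] makes it a submodule. *)
pose L := (sdpair1 ('MR rho)%gact @*^-1 K)%G.
have eK : sdpair1 ('MR rho)%gact @* L = K.
  by rewrite morphpreK.
have modL : mxmodule rho (rowg_mx L).
  apply/mxmoduleP=> g _; apply/row_subP=> i; rewrite row_mul -mem_rowg rowg_mxK.
  have : row i (rowg_mx L) \in L by rewrite -{2}rowg_mxK mem_rowg row_sub.
  rewrite !inE /= => Kw; rewrite -[sdpair1 _ _]/(nu _) -nuJ memJ_norm //.
  by apply: (subsetP nKH); apply/mem_Hmod; exists g.
have full : row_full (rowg_mx L).
  apply: irr => //; rewrite rowg_mx_eq0; apply: contra ntK => /eqP eL.
  by rewrite -eK /= eL morphim1.
have eL : L :=: setT.
  apply/eqP; rewrite -subTset; apply/subsetP=> w _.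
  by rewrite -(rowg_mxK L) mem_rowg submx_full.
by rewrite -eK eL.
Qed.

Lemma model_irr_semidirect r :
    [set: T] \isog 'D_(r.*2) -> mx_irreducible rho ->
  irr_semidirect_dihedral p r [set: model]%G.
Proof.
move=> isoT irr; apply/irr_semidirectP; exists Nmod, Hmod; split.
- exact: model_sdprod.
- apply: isog_trans _ isoT; rewrite isog_sym.
  exact: sub_isog (subxx _) (injm_sdpair2 _).
- exact: abelem_Nmod.
- exact: minnormal_model.
Qed.

Lemma model_morphism (rT : finGroupType) (phi : 'rV['F_p]_n -> rT)
    (psi : {morphism [set: T] >-> rT}) :
    (forall v w, phi (v + w)%R = phi v * phi w) ->
    (forall w g, phi w ^ psi g = phi (w *m rho g)%R) ->
  exists F : {morphism [set: model] >-> rT},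
    (forall w, F (nu w) = phi w) /\ (forall g, F (eta g) = psi g).
Proof.
move=> phiD phiJ.
have phiM : {in [set: 'rV['F_p]_n] &, {morph phi : v w / v * w}}.
  by move=> v w _ _; apply: phiD.
have act : {in [set: 'rV['F_p]_n] & [set: T],
    morph_act ('MR rho)%gact 'J (Morphism phiM) psi}.
  by move=> w g _ _; rewrite /= mx_repr_actE ?inE // -phiJ.
exists (xsdprod_morphism act); split=> [w|g] /=.
  rewrite /xsdprodm sdprodmEl ?mem_morphim ?inE //=.
  by rewrite /restrm /= invmE ?inE.
rewrite /xsdprodm sdprodmEr ?mem_morphim ?inE //=.
by rewrite /restrm /= invmE ?inE.
Qed.

Lemma model_morphism_inj (rT : finGroupType) (P : {group rT})
    (F : {morphism [set: model] >-> rT}) :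
  F @* setT = P -> #|P| = #|model| -> 'injm F.
Proof. by move=> e c; rewrite -card_im_injm e c cardsT. Qed.

(** This is what makes the choice of the vector in a base map immaterial: vectors related by an
    invertible endomorphism give isomorphic maps. *)
Lemma centgmx_model_aut B : centgmx rho B -> B \in unitmx ->
  exists F : {morphism [set: model] >-> model},
    [/\ 'injm F, F @* setT = setT, forall w, F (nu w) = nu (w *m B)%R
      & forall g, F (eta g) = eta g].
Proof.
move=> /centgmxP cB uB.
have [||F [F1 F2]] := @model_morphism model (fun w => nu (w *m B)%R)
    (sdpair2_morphism ('MR rho)%gact).
- by move=> v w; rewrite mulmxDl nuD.
- by move=> w g; rewrite [LHS]nuJ -!mulmxA cB ?inE.
have im : F @* setT = setT.
  apply/eqP; rewrite -subTset -{1}(sdprodW model_sdprod) mul_subG //.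
    apply/subsetP=> _ /mem_Nmod[w ->]; rewrite -[w](mulmxKV uB) -F1.
    by rewrite mem_morphim ?inE.
  by apply/subsetP=> _ /mem_Hmod[g ->]; rewrite -[eta g]F2 mem_morphim ?inE.
exists F; split=> //.
by apply: (@model_morphism_inj _ [set: model]%G); rewrite ?cardsT.
Qed.

End Model.

(** The conjugation action on N is pulled back along the morphism with x to u and y to z, so the
    marked generators are remembered. Quantifying over all similar [rho'] lets a member of a fixed
    list of representatives take the place of [rho]. *)
Lemma frame_repr p r (T rT : finGroupType) (x y : T) (P N : {group rT}) (u z : rT) :
    prime p -> <<[set x; y]>> = setT -> #|T| = r.*2 ->
    x ^+ 2 = 1 -> y ^+ 2 = 1 -> (x * y) ^+ r = 1 ->
    u ^+ 2 = 1 -> z ^+ 2 = 1 -> (u * z) ^+ r = 1 ->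
    N ><| <<[set u; z]>> = P -> #|<<[set u; z]>>| = r.*2 ->
    p.-abelem N -> minnormal N <<[set u; z]>> ->
  exists n (rho : mx_representation 'F_p [set: T]%G n),
    mx_irreducible rho /\
    forall n' (rho' : mx_representation 'F_p [set: T]%G n'), mx_rsim rho rho' ->
      exists F : {morphism [set: model rho'] >-> rT},
      [/\ 'injm F, F @* setT = P, F (eta rho' x) = u, F (eta rho' y) = z
        & F @* Nmod rho' = N].
Proof.
move=> p_pr gen cT x2 y2 xyr u2 z2 uzr sd cQ abelN minN.
have [psi [psix psiy]] := invol_pair_morphism gen cT x2 y2 xyr u2 z2 uzr.
have imp : psi @* setT = <<[set u; z]>>.
  rewrite -[X in _ @* X]gen morphim_gen ?subsetT // morphimU !morphim_set1 ?inE //.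
  by rewrite psix psiy.
have /andP[ntN nNQ] := mingroupp minN.
have Qpsi g : psi g \in <<[set u; z]>> by rewrite -imp mem_morphim ?inE.
pose rQ := abelem_repr abelN ntN nNQ.
have rhoP : mx_repr [set: T]%G (fun g => rQ (psi g)).
  split=> [|g h _ _]; first by rewrite morph1 repr_mx1.
  by rewrite morphM ?inE // repr_mxM.
exists _, (MxRepresentation rhoP); split.
  have /(abelem_mx_irrP abelN ntN nNQ)/mx_irrP[n0 irr] := minN.
  apply/mx_irrP; split=> // U /mxmoduleP modU; apply: irr; apply/mxmoduleP=> h Qh.
  have /morphimP[g _ _ ->] : h \in psi @* setT by rewrite imp.
  by apply: modU; rewrite inE.
move=> n' rho' /mx_rsim_sym [B en freeB homB].
pose phi w := rVabelem abelN ntN (w *m B)%R.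
have [||F [F1 F2]] := @model_morphism p n' T rho' rT phi psi.
- by move=> v w; rewrite /phi mulmxDl rVabelemD.
- move=> w g; rewrite /phi -mulmxA homB ?inE // mulmxA /=.
  by rewrite rVabelemJ.
have uB : row_full B by rewrite /row_full (eqP freeB) en.
have imN : F @* Nmod rho' = N.
  apply/setP=> t; apply/morphimP/idP => [[s _ /mem_Nmod[w ->] ->]|Nt].
    by rewrite F1 mem_rVabelem.
  have [w' e] := row_fullP uB.
  exists (nu rho' (abelem_rV abelN ntN t *m w')%R); rewrite ?inE //.
    by apply/mem_Nmod; eexists.
  by rewrite F1 /phi -mulmxA e mulmx1 abelem_rV_K.
have imP : F @* setT = P.
  rewrite -[X in _ @* X](sdprodW (model_sdprod rho')) morphimMl ?subsetT // -(sdprodW sd) imN.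
  congr (_ * _); rewrite -imp; apply/setP=> t.
  apply/morphimP/morphimP => [[s _ /mem_Hmod[g ->] ->]|[g _ _ ->]].
    by exists g; rewrite ?inE.
  by exists (eta rho' g); rewrite ?inE //; apply/mem_Hmod; exists g.
exists F; split=> //; rewrite ?F2 //.
apply: (model_morphism_inj imP); rewrite -(sdprod_card sd) cQ card_model // cT.
congr (_ * _)%N; rewrite -(card_abelem_rV abelN ntN) card_mx mul1n card_Fp // en.
by [].
Qed.

(** * Irreducible dihedral modules and vectors fixed by a reflection *)

Local Open Scope ring_scope.

Lemma horner_mx_intertwine (R : comNzRingType) n (S A B : 'M[R]_n.+1) q :
  S * A = B * S -> S * horner_mx A q = horner_mx B q * S.
Proof.
move=> SA; elim/poly_ind: q => [|q c IH]; first by rewrite !rmorph0 mulr0 mul0r.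
rewrite !rmorphD !rmorphM /= !horner_mx_X !horner_mx_C mulrDr mulrDl mulrA IH.
by rewrite -!mulrA SA; congr (_ + _); exact: scalar_mxC.
Qed.

Section DihedralModules.

Variables (F : fieldType) (T : finGroupType) (n' : nat).
Local Notation n := n'.+1.
Variable rho : mx_representation F [set: T]%G n.
Variables x y : T.
Hypotheses (genT : <<[set x; y]>>%g = setT) (x2 : (x ^+ 2 = 1)%g) (y2 : (y ^+ 2 = 1)%g).
Hypothesis irr : mx_irreducible rho.

Local Notation X := (rho x).
Local Notation Y := (rho y).
Local Notation A := (rho (x * y)%g).
Local Notation A' := (rho (y * x)%g).

Let rhoM g h : rho (g * h)%g = rho g * rho h.
Proof. by rewrite repr_mxM ?inE. Qed.

Let rhoX g i : rho (g ^+ i)%g = rho g ^+ i.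
Proof. by rewrite repr_mxX ?inE. Qed.

Let XX : X * X = 1.
Proof. by rewrite -rhoM -expg2 x2 repr_mx1. Qed.

Let YY : Y * Y = 1.
Proof. by rewrite -rhoM -expg2 y2 repr_mx1. Qed.

Lemma dihedral_mxmodule m (U : 'M_(m, n)) :
  (U *m X <= U)%MS -> (U *m Y <= U)%MS -> mxmodule rho U.
Proof.
move=> UX UY; rewrite /mxmodule /= -genT gen_subG subUset !sub1set !inE /=.
by rewrite UX UY.
Qed.

Lemma dihedral_centgmx B : B *m X = X *m B -> B *m Y = Y *m B -> centgmx rho B.
Proof.
move=> BX BY; rewrite /centgmx /= -genT gen_subG subUset !sub1set !inE /=.
by rewrite BX BY !eqxx.
Qed.

Section FixedVector.

Variable v : 'rV[F]_n.
Hypotheses (nzv : v != 0) (vX : v *m X = v).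

(** The exponents decrease along the rows, so that pairing with the translates of the functional
    dual to v A^n' gives a unitriangular matrix. *)
Definition krylov : 'M[F]_n := \matrix_(l < n) (v *m A ^+ (n' - l)).

Lemma sub_krylov q : (v *m horner_mx A q <= krylov)%MS.
Proof.
rewrite (divp_eq q (char_poly A)) rmorphD rmorphM /= Cayley_Hamilton mulr0 add0r.
set s := q %% _.
have sz : (size s <= n)%N.
  rewrite -ltnS -(size_char_poly A) ltn_modp.
  by rewrite -size_poly_eq0 size_char_poly.
rewrite -[s]coefK (poly_def) linear_sum mulmx_sumr.
apply: summx_sub => i _; rewrite linearZ /= -scalemxAr scalemx_sub //.
rewrite rmorphXn /= horner_mx_X.
have -> : v *m A ^+ i = row (inord (n' - i)) krylov.
  have lei : (i <= n')%N by rewrite -ltnS (leq_trans (ltn_ord i) sz).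
  by rewrite rowK inordK ?subKn // ltnS leq_subr.
exact: row_sub.
Qed.

Let sub_krylovX i : (v *m A ^+ i <= krylov)%MS.
Proof. by have := sub_krylov 'X^i; rewrite rmorphXn /= horner_mx_X. Qed.

(* x reverses the powers of the rotation and fixes v, so the span of the v A^i is
   stable under the whole dihedral group. *)
Lemma krylov_unit : krylov \in unitmx.
Proof.
have mX j : exists m, v *m A ^+ j *m X = v *m A ^+ m.
  exists (#[(x * y)%g].-1 * j)%N.
  rewrite -!rhoX -mulmxA -repr_mxM ?inE // conjgC invol_prodJl //.
  by rewrite repr_mxM ?inE // mulmxA vX expgM -invg_expg expgVn.
rewrite -row_full_unit; case/mx_irrP: irr => _; apply.
  apply: dihedral_mxmodule; apply/row_subP=> l; rewrite row_mul rowK.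
    by have [m ->] := mX (n' - l)%N.
  have -> : Y = X *m A by rewrite -[RHS]rhoM mulgA -expg2 x2 mul1g.
  rewrite mulmxA; have [m ->] := mX (n' - l)%N.
  by rewrite -mulmxA -[_ *m A]exprSr.
apply: contra nzv => /eqP k0; have := sub_krylovX 0.
by rewrite k0 expr0 mulmx1 submx0.
Qed.

Lemma cyclic_fixed_vector w : exists q, w = v *m horner_mx A q.
Proof.
pose c := w *m invmx krylov.
exists (\sum_l c 0 l *: 'X^(n' - l)).
rewrite linear_sum mulmx_sumr -[LHS](mulmxKV krylov_unit) -/c.
rewrite mulmx_sum_row; apply: eq_bigr => l _.
by rewrite linearZ /= rmorphXn /= horner_mx_X -scalemxAr rowK.
Qed.

(* If w = v q(A), then (q(A) + q(A^-1)) / 2 is an endomorphism carrying v to w. *)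
Lemma fixed_vector_transitive w : 2%:R != 0 :> F -> w != 0 -> w *m X = w ->
  exists B, [/\ centgmx rho B, B \in unitmx & v *m B = w].
Proof.
move=> nz2 nzw wX; have [q wq] := cyclic_fixed_vector w.
have XA : X * A = A' * X by rewrite -!rhoM mulgA -expg2 x2 mul1g -mulgA -expg2 x2 mulg1.
have XA' : X * A' = A * X by rewrite -!rhoM mulgA.
have AA' : A * A' = A' * A.
  by rewrite -!rhoM -(invol_prodV x2 y2) mulgV mulVg.
pose B := (2%:R)^-1 *: (horner_mx A q + horner_mx A' q).
have cBX : B * X = X * B.
  rewrite /B -scalerAl -scalerAr mulrDl mulrDr.
  by rewrite (horner_mx_intertwine q XA) (horner_mx_intertwine q XA') addrC.
have cBA : B * A = A * B.
  rewrite /B -scalerAl -scalerAr mulrDl mulrDr.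
  rewrite (horner_mx_intertwine q (erefl (A * A))).
  by rewrite (horner_mx_intertwine q AA').
have cB : centgmx rho B.
  apply: dihedral_centgmx; first exact: cBX.
  have -> : Y = X * A by rewrite -rhoM mulgA -expg2 x2 mul1g.
  by rewrite -[LHS]/(B * (X * A)) mulrA cBX -mulrA cBA mulrA.
have vB : v *m B = w.
  (* Since x fixes v and w and exchanges A with its inverse, v q(A^-1) = v X q(A^-1) = v q(A) X = w
     X = w. *)
  have vA' : v *m horner_mx A' q = w.
    by rewrite -{1}vX -mulmxA [X *m _](horner_mx_intertwine q XA') mulmxA -wq wX.
  rewrite /B -scalemxAr mulmxDr -wq vA' -mulr2n -scaler_nat scalerA mulVf //.
  exact: scale1r.
exists B; split=> //; apply: (mx_Schur irr cB).
by apply: contra nzw => /eqP B0; rewrite -vB B0 mulmx0.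
Qed.

(* The functional f0 is dual to the last vector of the Krylov basis; its translates
   by powers of A are the Praeger-Xu coordinates. *)
Lemma PX_functional : exists f0 : 'cV[F]_n,
  (forall w : 'rV_n, (forall k, (k < n)%N -> w *m A ^+ k *m f0 = 0) -> w = 0) /\
  (forall w : 'rV_n, (forall k, (k < n')%N -> w *m A ^+ k *m f0 = 0) <->
             exists c, w = c *: v).
Proof.
pose f0 : 'cV[F]_n := invmx krylov *m delta_mx ord0 0.
have vf k : (k <= n')%N -> v *m A ^+ k *m f0 = (k == n')%:R%:M.
  move=> lek; have lt : (n' - k < n)%N by rewrite ltnS leq_subr.
  have -> : v *m A ^+ k = row (Ordinal lt) krylov by rewrite rowK /= subKn.
  rewrite -row_mul /f0 mulKVmx ?krylov_unit //.
  apply/matrixP=> i j; rewrite !ord1 !mxE eqxx andbT mulr1n -val_eqE /=.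
  by rewrite subn_eq0 eqn_leq lek.
pose Fm : 'M[F]_n := \matrix_(i, k) (A ^+ k *m f0) i 0.
have colF k : col k Fm = A ^+ k *m f0.
  by apply/matrixP=> i j; rewrite !mxE ord1.
have uF : Fm \in unitmx.
  (* The entry (l, i) is v A^(n' - l + i) f0, which is 1 for i = l and 0 for i < l; transposition
     brings the product to the lower triangular form of [det_trig]. *)
  have : krylov *m Fm \in unitmx.
    rewrite -unitmx_tr unitmxE det_trig.
      rewrite big1 ?unitr1 // => i _; rewrite mxE.
      transitivity ((row i krylov *m col i Fm) 0 0).
        by rewrite !mxE; apply: eq_bigr => j _; rewrite !mxE.
      rewrite colF rowK -mulmxA (mulmxA (A ^+ _)) -[A ^+ _ *m _]exprD.
      by rewrite subnK -1?ltnS // mulmxA vf // eqxx mxE.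
    apply/is_trig_mxP=> i j ltij; rewrite mxE.
    transitivity ((row j krylov *m col i Fm) 0 0).
      by rewrite !mxE; apply: eq_bigr => k _; rewrite !mxE.
    have lej : (j <= n')%N by rewrite -ltnS.
    have lt : (n' - j + i < n')%N by rewrite -ltn_subRL subKn.
    rewrite colF rowK -mulmxA (mulmxA (A ^+ _)) -[A ^+ _ *m _]exprD mulmxA vf.
      by rewrite (ltn_eqF lt) mxE.
    exact: ltnW.
  by rewrite unitmx_mul krylov_unit.
have inj (w : 'rV_n) : (forall k, (k < n)%N -> w *m A ^+ k *m f0 = 0) -> w = 0.
  move=> w0; rewrite -[w](mulmxK uF) (_ : w *m Fm = 0) ?mul0mx //.
  apply/rowP=> k.
  transitivity ((w *m col k Fm) 0 0).
    by rewrite !mxE; apply: eq_bigr => j _; rewrite !mxE.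
  by rewrite colF mulmxA w0 // !mxE.
exists f0; split=> // w; split=> [w0|[c ->] k ltk]; last first.
  rewrite -!scalemxAl vf ?(ltnW ltk) // (ltn_eqF ltk).
  by apply/matrixP=> i j; rewrite !mxE mul0rn mulr0.
exists ((w *m A ^+ n' *m f0) 0 0); apply/eqP; rewrite -subr_eq0; apply/eqP.
apply: inj => k; rewrite ltnS leq_eqVlt => /orP[/eqP->|ltk].
  rewrite !mulmxBl -!scalemxAl vf // eqxx scalemx1 -mx11_scalar subrr //.
rewrite !mulmxBl -!scalemxAl (w0 k ltk) (vf k (ltnW ltk)) (ltn_eqF ltk).
by rewrite (raddf0 (@scalar_mx _ _)) scaler0 subr0.
Qed.

End FixedVector.

(** The rows of X + 1 are fixed by X, so X = -1. Then Y commutes with the whole action, and by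
    Schur's lemma Y - 1 is zero or invertible; in the latter case (Y - 1)(Y + 1) = 0 gives Y =
    -1. *)
Lemma no_fixed_vector : kermx (X - 1%:M) = 0 -> X = - 1%:M /\ (Y = 1%:M \/ Y = - 1%:M).
Proof.
move=> k0.
have eX : X = -1.
  apply/eqP; rewrite -addr_eq0 -submx0 -k0; apply/sub_kermxP.
  by rewrite -[LHS]/((X + 1) * (X - 1)) mulrDl mul1r mulrBr XX mulr1 addrC subrKA subrr.
split=> //; have [Y1|nY] := eqVneq Y 1; [by left|right].
have u : Y - 1 \in unitmx.
  apply: (mx_Schur irr); last by rewrite subr_eq0.
  apply: dihedral_centgmx.
    by rewrite eX -[LHS]/((Y - 1) * -1) -[RHS]/(-1 * (Y - 1)) mulrN1 mulN1r.
  by rewrite -[LHS]/((Y - 1) * Y) -[RHS]/(Y * (Y - 1)) mulrBl mulrBr mul1r mulr1.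
apply/eqP; rewrite -addr_eq0; apply/eqP; rewrite -[LHS](mulKmx u).
rewrite (_ : _ *m (Y + _) = 0) ?mulmx0 //.
by rewrite -[LHS]/((Y - 1) * (Y + 1)) mulrDr mulr1 mulrBl mul1r YY addrC subrKA subrr.
Qed.

Lemma scalar_dihedral_dim1 a b : X = a%:M -> Y = b%:M -> n' = 0%N.
Proof.
move=> Xa Yb; pose U : 'M[F]_n := delta_mx 0 0.
have [_ /(_ U)] := (mx_irrP _).1 irr; rewrite /row_full mxrank_delta => full.
apply/eqP; rewrite -eqSS eq_sym; apply: full.
  by apply: dihedral_mxmodule; rewrite ?Xa ?Yb mul_mx_scalar scalemx_sub.
by rewrite -mxrank_eq0 mxrank_delta.
Qed.

End DihedralModules.
Local Close Scope ring_scope.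

Lemma graph_iso_via (D D' : finType) (M : omap D) (Gam : agraph)
    (g1 : D' -> D) (g2 : D' -> arc Gam) (rv : D' -> D') :
    bijective g1 -> bijective g2 ->
    (forall d, mL M (g1 d) = g1 (rv d)) -> (forall d, arev (g2 d) = g2 (rv d)) ->
    (forall d e, (atail (g2 d) == atail (g2 e)) = (g1 e \in porbit (mR M) (g1 d))) ->
    (forall v : vert Gam, exists a, atail a = v) ->
  graph_iso M Gam.
Proof.
move=> [h1 g1K h1K] bij2 L1 L2 tl surj.
exists (fun x => g2 (h1 x)); split=> //.
- by apply: bij_comp bij2 _; exists g1.
- by move=> x; rewrite L2; congr g2; apply: (can_inj g1K); rewrite h1K -L1 h1K.
- by move=> x y; rewrite tl !h1K.
Qed.

(** * Dihedral elements as arcs of a cycle *)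

Section DihedralElements.

Variables (T : finGroupType) (x y : T) (r : nat).
Hypotheses (r3 : 2 < r) (genT : <<[set x; y]>> = setT) (cT : #|T| = r.*2).
Hypotheses (x2 : x ^+ 2 = 1) (y2 : y ^+ 2 = 1) (xyr : (x * y) ^+ r = 1).

Let r1 : 1 < r. Proof. exact: ltnW. Qed.

Lemma order_invol_prod : #[x * y] = r.
Proof.
apply/eqP; rewrite eqn_leq dvdn_leq ?order_dvdn ?xyr ?(ltnW r1) //=.
by rewrite -leq_double -cT -cardsT -genT card_gen_invol.
Qed.

Lemma expg_ZrD1 (g : T) (i : 'Z_r) : g ^+ r = 1 -> g ^+ (i + 1)%R = g ^+ i * g.
Proof.
rewrite -{1}(Zp_cast r1) => gr.
by rewrite /= expg_mod // expgD expg_mod // expg1.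
Qed.

Definition dpos (d : 'Z_r * bool) : 'Z_r := if d.2 then (d.1 + 1)%R else d.1.

(** The forward arc at position i is (xy)^i x, and right multiplication by y turns it into
    (xy)^(i+1), the reversed arc at the other end. *)
Definition dih (d : 'Z_r * bool) : T := (x * y) ^+ dpos d * x ^+ (~~ d.2).

Lemma dihL d : dih d * y = dih (d.1, ~~ d.2).
Proof.
case: d => i []; rewrite /dih /dpos /= ?expg0 ?expg1 ?mulg1 expg_ZrD1 //.
  by rewrite -!mulgA -(expg2 y) y2 mulg1.
by rewrite mulgA.
Qed.

Lemma xNrot : x \notin <[x * y]>.
Proof.
have /eqP nc : x * y != y * x.
  by apply: (invol_pair_noncomm x2 y2 r3); rewrite genT cardsT.
apply/negP=> /(centsP (cycle_abelian (x * y)))/(_ _ (cycle_id _)).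
by rewrite /commute -mulgA => /mulgI.
Qed.

Lemma dih_pos_inj i j (a b : bool) :
  (x * y) ^+ (i : 'Z_r) * x ^+ a = (x * y) ^+ (j : 'Z_r) * x ^+ b -> i = j /\ a = b.
Proof.
have ltr (k : 'Z_r) : k < r by have := ltn_ord k; rewrite [X in _ < X]Zp_cast.
move=> e.
have ab : a = b.
  apply/eqP/negP=> /negP nab; case/negP: xNrot.
  move: e nab; case: a; case: b => //= + _; rewrite expg0 expg1 mulg1.
    by move=> /(canRL (mulKg _)) h; rewrite {1}h groupM ?groupV ?mem_cycle.
  by move=> /esym/(canRL (mulKg _)) h; rewrite {1}h groupM ?groupV ?mem_cycle.
split=> //; move: e; rewrite ab => /mulIg/eqP; rewrite eq_expg_mod_order.
by rewrite order_invol_prod !modn_small ?ltr // => /eqP/val_inj.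
Qed.

Lemma dih_inj : injective dih.
Proof.
move=> [i a] [j b] /dih_pos_inj[] /=; rewrite /dpos /= => + /negb_inj ab.
by rewrite -ab; case: (a) => [/addIr ->|->].
Qed.

Lemma dih_bij : bijective dih.
Proof.
apply: inj_card_bij dih_inj _.
by rewrite cT card_prod card_bool card_ord Zp_cast // muln2.
Qed.

Lemma dih_coset d e :
  (exists a : bool, dih e = dih d * x ^+ a) <-> dpos d = dpos e.
Proof.
split=> [[a]|pe].
  rewrite /dih -mulgA => h.
  have [c xc] : exists c : bool, x ^+ (~~ d.2) * x ^+ a = x ^+ c.
    case: (~~ _); case: a {h}; [exists false|exists true|exists true|exists false];
      by rewrite ?expg0 ?expg1 ?mulg1 ?mul1g -?expg2.
  by rewrite xc in h; case/dih_pos_inj: h.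
rewrite /dih pe; exists (d.2 (+) e.2); rewrite -mulgA; congr (_ * _).
by case: d.2; case: e.2; rewrite ?expg0 ?expg1 ?mulg1 ?mul1g -?expg2.
Qed.

(** For valency 2 this is applied with the whole model as the dihedral group, of order 2pr, which
    yields the cycle of length pr. *)
Lemma Cyc_graph_iso : graph_iso (regmap x y) (Cycgraph r).
Proof.
apply: (@graph_iso_via _ _ _ (Cycgraph r) dih id (fun d => (d.1, ~~ d.2))).
- exact: dih_bij.
- by exists id.
- by move=> d; rewrite regmap_LE dihL.
- by [].
- move=> d e; rewrite porbit_regmap; apply/eqP/idP => [pe|].
    have /dih_coset[a ->] : dpos d = dpos e by [].
    by rewrite mulKg mem_cycle.
  move=> /cycleP[k xk]; apply/dih_coset; exists (odd k).
  rewrite -(mulKVg (dih d) (dih e)) xk -{1}(odd_double_half k) expgD -mul2n.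
  by rewrite expgM x2 expg1n mulg1.
- by move=> v; exists (v, false).
Qed.

End DihedralElements.

Lemma PX_tail_surj p r s (v : PX_vert p r s) : exists a, PX_tail a = v.
Proof.
case: v => i Y.
pose g (k : 'I_s.+1) : 'Z_p := if insub (k : nat) is Some j then Y j else 0%R.
exists (i, finfun g, false); rewrite /PX_tail; congr (_, _); apply/ffunP=> k.
by rewrite !ffunE /g /= insubT //= => lt; congr (Y _); apply: val_inj.
Qed.

(** * The maps of valency 2p and 2 on a model *)

Section ModelMaps.

Variables (p r n' : nat) (T : finGroupType) (x y : T).
Local Notation n := n'.+1.
Variable rho : mx_representation 'F_p [set: T]%G n.
Hypotheses (p_pr : prime p) (p_odd : odd p) (r3 : 2 < r) (pr : ~~ (p %| r)).
Hypotheses (genT : <<[set x; y]>> = setT) (cT : #|T| = r.*2).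
Hypotheses (x2 : x ^+ 2 = 1) (y2 : y ^+ 2 = 1) (xyr : (x * y) ^+ r = 1).
Hypothesis irr : mx_irreducible rho.

Local Notation nu := (nu rho).
Local Notation eta := (eta rho).
Local Notation A := (rho (x * y)).

Let r_gt1 : 1 < r. Proof. exact: ltnW. Qed.

Let rhoM g h : rho (g * h) = (rho g *m rho h)%R.
Proof. by rewrite repr_mxM ?inE. Qed.

Let nc : x * y != y * x.
Proof. by apply: (invol_pair_noncomm x2 y2 r3); rewrite genT cardsT. Qed.

Lemma model_nonabelian : ~~ abelian [set: model rho].
Proof.
apply: contra nc => /centsP ab; apply/eqP/(@eta_inj _ _ _ rho).
by rewrite !etaM ab ?inE.
Qed.

Lemma model_generators_is_map (a z : model rho) :
  <<[set a; z]>> = setT -> z ^+ 2 = 1 -> is_map (regmap a z).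
Proof.
move=> gen z2; apply: regmap_is_map => //; apply/negP=> za.
case/negP: model_nonabelian; rewrite -gen.
apply: abelianS (cycle_abelian a); rewrite gen_subG subUset !sub1set za cycle_id.
by [].
Qed.

Lemma Fp_mulrn_eq0 (w : 'rV['F_p]_n) k : w != 0%R -> (w *+ k == 0)%R = (p %| k).
Proof.
move=> nzw; rewrite -scaler_nat scaler_eq0 (negPf nzw) orbF.
by rewrite (dvdn_pcharf (pchar_Fp p_pr)).
Qed.

Lemma sub_Hmod (K : {group model rho}) :
  eta x \in K -> eta y \in K -> Hmod rho \subset K.
Proof.
move=> Kx Ky; apply/subsetP=> _ /mem_Hmod[g ->].
have : g \in <<[set x; y]>> by rewrite genT inE.
move=> /gen_prodgP[m [c cP ->]].
elim: m c cP => [|m IH] c cP; first by rewrite big_ord0 eta1 group1.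
rewrite big_ord_recr /= etaM groupM //.
  by apply: IH => i; apply: cP.
by case/set2P: (cP ord_max) => ->.
Qed.

Lemma model_eqT (K : {group model rho}) : Nmod rho \subset K ->
  eta x \in K -> eta y \in K -> K = setT :> {set model rho}.
Proof.
move=> sN Kx Ky; apply/eqP; rewrite -subTset -(sdprodW (model_sdprod rho)).
by rewrite mul_subG ?sub_Hmod.
Qed.

Section FixedVectorMap.

Variable v : 'rV['F_p]_n.
Hypotheses (nzv : v != 0%R) (vX : (v *m rho x)%R = v).
Let a := nu v * eta x.
Let z := eta y.

Let aX k : a ^+ k = nu (v *+ k)%R * eta (x ^+ k).
Proof.
rewrite expgMn ?nuX ?etaX // /commute.
by rewrite conjgC nuJ vX.
Qed.

Let xodd k : x ^+ k = x ^+ (odd k).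
Proof.
by rewrite -{1}(odd_double_half k) expgD -mul2n expgM x2 expg1n mulg1.
Qed.

Lemma fixed_map_expp : a ^+ p = eta x.
Proof.
have /eqP e : (v *+ p == 0)%R by rewrite Fp_mulrn_eq0.
by rewrite aX e nu0 mul1g xodd p_odd.
Qed.

Lemma fixed_map_order : #[a] = p.*2.
Proof.
have x1 : x != 1 by apply: contra nc => /eqP ->; rewrite mulg1 mul1g.
have co : coprime 2 p by rewrite coprime2n.
apply/eqP; rewrite eqn_dvd order_dvdn -mul2n mulnC expgM fixed_map_expp -etaX x2.
rewrite eta1 eqxx /= mulnC Gauss_dvd //.
have := expg_order a; rewrite aX -[1]mulg1 -{1}(nu0 rho) -(eta1 rho).
move=> /nu_eta_inj[/eqP]; rewrite Fp_mulrn_eq0 // => -> /eqP; rewrite andbT.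
by rewrite xodd dvdn2; case: (odd _) => //; rewrite expg1 (negPf x1).
Qed.

Lemma fixed_map_gen : <<[set a; z]>> = setT.
Proof.
have Ka : a \in <<[set a; z]>> by rewrite mem_gen ?inE ?eqxx.
have Kx : eta x \in <<[set a; z]>> by rewrite -fixed_map_expp groupX.
have Ky : eta y \in <<[set a; z]>> by rewrite mem_gen ?inE ?eqxx ?orbT.
have Kv : nu v \in <<[set a; z]>> by rewrite -(mulgK (eta x) (nu v)) groupM ?groupV.
apply: model_eqT => //.
(* The generated subgroup contains the complement and meets N nontrivially in [nu v]; the
   intersection is stable under the complement, so minimality makes it all of N. *)
have /mingroupP[_ /(_ (Nmod rho :&: <<[set a; z]>>)%G) m] := minnormal_model p_pr irr.
suff <- : Nmod rho :&: <<[set a; z]>> = Nmod rho by apply: subsetIr.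
have sH : Hmod rho \subset <<[set a; z]>> by apply: sub_Hmod.
apply: m; rewrite ?subsetIl //; apply/andP; split.
  apply/trivgPn; exists (nu v); first by rewrite inE Kv andbT; apply/mem_Nmod; exists v.
  by apply: contra nzv => /eqP e; apply/eqP/(@nu_inj _ _ _ rho); rewrite e nu0.
apply: normsI; last exact: subset_trans sH (normG _).
by case/sdprodP: (model_sdprod rho).
Qed.

Let mem_cycle_a t :
  (exists c : 'F_p, exists b : bool, t = nu (c *: v)%R * eta (x ^+ b)) <-> t \in <[a]>.
Proof.
split=> [[c [b ->]]|/cycleP[k ->]]; last first.
  by exists k%:R%R, (odd k); rewrite scaler_nat aX xodd.
have ax : eta x \in <[a]> by rewrite -fixed_map_expp mem_cycle.
have av : nu v \in <[a]> by rewrite -(mulgK (eta x) (nu v)) groupM ?groupV ?cycle_id.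
by rewrite groupM ?etaX ?groupX // -(natr_Zp c) scaler_nat -nuX groupX.
Qed.

(** Graph coordinates lie in ['Z_p] and module coordinates in ['F_p]. Incidence only compares
    coordinates for equality, so an injection suffices. *)
Let toZ (c : 'F_p) : 'Z_p := inZp c.

Let toZ_inj : injective toZ.
Proof.
move=> c d /(congr1 val) /=.
have lt (e : 'F_p) : e < (Zp_trunc p).+2.
  by apply: leq_trans (ltn_ord e) _; rewrite pdiv_id.
by rewrite !modn_small // => /val_inj.
Qed.

Local Notation pt := ('Z_r * 'rV['F_p]_n * bool)%type.
Let dd (d : pt) : 'Z_r * bool := (d.1.1, d.2).
Let elt (d : pt) : model rho := nu d.1.2 * eta (dih x y (dd d)).

Let elt_bij : bijective elt.
Proof.
apply: inj_card_bij => [[[i w] b] [[j w'] c]|].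
  move=> /nu_eta_inj[/= -> /(dih_inj r3 genT cT x2 y2 xyr)].
  by rewrite /dd /= => -[-> ->].
rewrite card_model // cT !card_prod card_bool card_ord card_mx mul1n card_Fp //.
by rewrite Zp_cast // muln2 doubleMl mulnC.
Qed.

Let unitA i : (A ^+ i)%R \in unitmx.
Proof. by rewrite -repr_mxX ?inE // repr_mx_unit ?inE. Qed.

(** Vertices are cosets of [<[a]>], which is generated by [nu v] and [eta x]. Moving [nu v] past the
    dihedral part at position i turns v into v A^(-i), and A^i undoes this. The line of v is cut out
    by the n' coordinates that the tail of a Praeger-Xu arc retains. *)
Let elt_coset d e : elt e \in elt d *: <[a]> <->
  dpos (dd d) = dpos (dd e) /\
  exists c : 'F_p, ((e.1.2 - d.1.2) *m A ^+ dpos (dd d) = c *: v)%R.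
Proof.
have key (c : 'F_p) (b : bool) : elt d * (nu (c *: v)%R * eta (x ^+ b)) =
    nu (d.1.2 + c *: v *m invmx (A ^+ dpos (dd d)))%R * eta (dih x y (dd d) * x ^+ b).
  set h := dih x y (dd d).
  have E : eta h * nu (c *: v)%R = nu (c *: v *m invmx (A ^+ dpos (dd d)))%R * eta h.
    rewrite conjgCV -etaV nuJ; congr (nu _ * _); rewrite -!scalemxAl.
    congr (_ *: _)%R; rewrite /h /dih invMg (rhoM (x ^+ _)^-1) mulmxA.
    have -> : (v *m rho ((x ^+ (~~ (dd d).2))^-1)%g)%R = v.
      case: (~~ _); rewrite ?expg0 ?expg1 ?invg1 ?repr_mx1 ?mulmx1 //.
      by rewrite (involV x2).
    by rewrite repr_mxV ?inE // repr_mxX ?inE.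
  by rewrite /elt -/h nuD etaM !mulgA -(mulgA (nu d.1.2) (eta h)) E !mulgA.
split.
  rewrite mem_lcoset => /mem_cycle_a[c [b /(canRL (mulKVg _))]]; rewrite key.
  move=> /nu_eta_inj[ew eh]; split.
    by apply/(dih_coset r3 genT cT x2 y2 xyr); exists b.
  exists c; rewrite ew addrAC subrr add0r mulmxKV ?unitA //.
case=> /(dih_coset r3 genT cT x2 y2 xyr)[b eb] [c ec].
rewrite mem_lcoset; apply/mem_cycle_a; exists c, b; apply: (canLR (mulKg _)).
by rewrite key -ec mulmxK ?unitA // addrC subrK -eb.
Qed.

(* The edge (i, X) of the Praeger-Xu graph corresponds to the vector w with
   X_k = w A^(i + k) f0. *)
Lemma PX_graph_iso : graph_iso (regmap a z) (PXgraph p r n').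
Proof.
have [f0 [f0_inj f0_ker]] := PX_functional genT x2 y2 irr nzv vX.
pose co (w : 'rV['F_p]_n) i : 'Z_p := toZ ((w *m A ^+ i *m f0) 0 0)%R.
have coE w w' i : co w i = co w' i <-> ((w' - w) *m A ^+ i *m f0 = 0)%R.
  rewrite !mulmxBl; split=> [/toZ_inj e|/eqP].
    apply/eqP; rewrite subr_eq0; apply/eqP/matrixP=> s t; rewrite !ord1.
    exact: esym.
  by rewrite subr_eq0 /co => /eqP ->.
have Ar : (A ^+ r = 1)%R by rewrite -repr_mxX ?inE // xyr repr_mx1.
(* Positions wrap around modulo r, which is harmless because A^r = 1. *)
have coD1 w (i : 'Z_r) k : co w (i + 1 + k)%N = co w ((i + 1)%R + k)%N.
  rewrite /co; congr (toZ ((_ *m _ *m _)%R _ _)); rewrite !exprD; congr (_ * _)%R.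
  have Ar' : (A ^+ (Zp_trunc r).+2 = 1)%R by rewrite (Zp_cast r_gt1).
  by rewrite /= expr_mod // exprD expr_mod //.
pose coords (d : pt) : PX_arc p r n' :=
  (d.1.1, [ffun k : 'I_n => co d.1.2 (d.1.1 + k)%N], d.2).
have tailE d : PX_tail (coords d) =
    (dpos (dd d), [ffun k : 'I_n' => co d.1.2 (dpos (dd d) + k)%N]).
  case: d => [[i w] []]; rewrite /PX_tail /coords /= /dpos /=; congr (_, _);
    apply/ffunP=> k; rewrite !ffunE //=.
  by rewrite /bump leq0n addnA coD1.
apply: (@graph_iso_via _ _ _ (PXgraph p r n') elt coords (fun d => (d.1, ~~ d.2))).
- exact: elt_bij.
- apply: inj_card_bij => [[[i w] b] [[j w'] c]|].
    case=> -> /ffunP e ->; congr (_, _, _); apply/eqP; rewrite eq_sym -subr_eq0.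
    apply/eqP/(can_inj (mulmxK (unitA j))).
    rewrite mul0mx; apply: f0_inj => k ltk.
    have := e (Ordinal ltk); rewrite !ffunE /= => /coE.
    by rewrite exprD !mulmxA.
  rewrite !card_prod card_bool !card_ord card_ffun card_mx mul1n !card_ord.
  by rewrite pdiv_id.
- move=> d; rewrite regmap_LE /elt /z -mulgA -etaM dihL //.
- by case=> [[i w] b].
- move=> d e; rewrite porbit_regmap -mem_lcoset [atail _]tailE [X in _ == X]tailE.
  apply/eqP/idP => [[ep /ffunP eX]|/elt_coset[ep ker]].
    apply/elt_coset; split=> //; apply/f0_ker => k ltk.
    have := eX (Ordinal ltk); rewrite !ffunE -ep => /coE.
    by rewrite exprD !mulmxA.
  rewrite -ep; congr (_, _); apply/ffunP=> k; rewrite !ffunE; apply/coE.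
  rewrite exprD mulmxA; exact: (f0_ker _).2 ker k (ltn_ord k).
- exact: PX_tail_surj.
Qed.

End FixedVectorMap.

Section SignMap.

Variable w : 'rV['F_p]_n.
Hypotheses (nzw : w != 0%R) (n0 : n' = 0%N).
Hypotheses (eX : rho x = (- 1%:M)%R) (eY : rho y = (- 1%:M)%R).
Let a := eta x.
Let z := nu w * eta y.

Lemma sign_map_sqr : z ^+ 2 = 1.
Proof.
rewrite expg2 /z mulgA -(mulgA (nu w)) (conjgCV (eta y)) -etaV (involV y2) nuJ eY.
by rewrite mulmxN mulmx1 nuN mulgA mulgV mul1g -etaM -expg2 y2 eta1.
Qed.

Lemma sign_map_order : #[a] = 2.
Proof.
have x1 : x != 1 by apply: contra nc => /eqP ->; rewrite mulg1 mul1g.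
apply/prime_nt_dvdP; rewrite ?order_eq1 //; last by rewrite order_dvdn -etaX x2 eta1.
by apply: contra x1 => /eqP e; apply/eqP/(@eta_inj _ _ _ rho); rewrite -/a e eta1.
Qed.

(* The rotation xy centralises N, so (a z)^r is a nonzero multiple of w. *)
Lemma sign_map_gen : <<[set a; z]>> = setT.
Proof.
have Ka : eta x \in <<[set a; z]>> by rewrite mem_gen ?inE ?eqxx.
have Kz : z \in <<[set a; z]>> by rewrite mem_gen ?inE ?eqxx ?orbT.
have cr : (a * z) ^+ r = nu (- w *+ r)%R.
  rewrite /a /z mulgA (conjgCV (eta x)) -etaV (involV x2) nuJ eX mulmxN mulmx1.
  rewrite -mulgA -etaM expgMn ?nuX -?etaX ?xyr ?eta1 ?mulg1 // /commute.
  rewrite [RHS]conjgCV -etaV (invol_prodV x2 y2) nuJ rhoM eX eY.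
  by rewrite mulmxN mulmx1 opprK mulmx1.
have sN : Nmod rho \subset <<[set a; z]>>.
  apply: prime_meetG.
    rewrite card_injm ?subsetT ?injm_sdpair1 // cardsT card_mx mul1n card_Fp //.
    by rewrite n0 expn1.
  apply/trivgPn; exists (nu (- w *+ r)%R).
    apply/setIP; split; first by apply/mem_Nmod; eexists.
    by rewrite -cr groupX // (groupM Ka Kz).
  apply: contra pr => /eqP e; rewrite -(@Fp_mulrn_eq0 (- w)%R) ?oppr_eq0 //.
  by apply/eqP/(@nu_inj _ _ _ rho); rewrite e nu0.
apply: model_eqT => //; rewrite -(mulKg (nu w) (eta y)) groupM ?groupV //.
by apply: (subsetP sN); apply/mem_Nmod; exists w.
Qed.

Lemma sign_map_graph_iso : graph_iso (regmap a z) (Cycgraph (p * r)).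
Proof.
have cM : #|model rho| = (p * r).*2 by rewrite card_model // n0 expn1 cT doubleMr.
have a2 : a ^+ 2 = 1 by rewrite -sign_map_order expg_order.
apply: Cyc_graph_iso => //.
- by rewrite (leq_trans r3) // leq_pmull ?prime_gt0.
- exact: sign_map_gen.
- exact: sign_map_sqr.
- apply: invol_prod_order; rewrite ?sign_map_gen ?sign_map_sqr ?cardsT //.
  exact: model_nonabelian.
Qed.

End SignMap.

Lemma Nmod_Hall : p.-Hall([set: model rho]) (Nmod rho).
Proof.
have cN : #|Nmod rho| = (p ^ n)%N.
  by rewrite card_injm ?subsetT ?injm_sdpair1 // cardsT card_mx mul1n card_Fp.
have r0 : 0 < r.*2 by rewrite double_gt0 ltnW.
rewrite pHallE subsetT cN cardsT card_model // cT partnM ?expn_gt0 ?(prime_gt0 p_pr) //=.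
have pn : p.-nat (p ^ n)%N by rewrite pnatX pnat_id.
rewrite (part_pnat_id pn) part_p'nat ?muln1 //.
rewrite p'natE //; apply: contra pr; rewrite -muln2 Euclid_dvdM // => /orP[//|].
move=> /(dvdn_leq (isT : 0 < 2)) p2.
by move: p_odd; rewrite (_ : p = 2) //; apply/eqP; rewrite eqn_leq p2 prime_gt1.
Qed.

End ModelMaps.

Lemma opp_eigen_dim1 (F : fieldType) m (A : 'M[F]_m.+1) (w : 'rV_m.+1) :
  m = 0%N -> w != 0%R -> (w *m A = - w)%R -> A = (- 1%:M)%R.
Proof.
move=> m0; rewrite {m}m0 in A w *; rewrite [A]mx11_scalar mul_mx_scalar => nzw e.
rewrite -raddfN; congr (_%:M)%R; apply/eqP; rewrite -subr_eq0 opprK.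
have : ((A 0 0 + 1) *: w == 0)%R by rewrite scalerDl scale1r e addNr.
by rewrite scaler_eq0 (negPf nzw) orbF.
Qed.

(** * Base maps, their isomorphisms and their completeness *)

Section IrreducibleMaps.

Variables (p r : nat) (T : finGroupType) (x y : T).
Hypotheses (p_pr : prime p) (p_odd : odd p) (r3 : 2 < r) (pr : ~~ (p %| r)).
Hypotheses (genT : <<[set x; y]>> = setT) (isoT : [set: T] \isog 'D_(r.*2)).
Hypotheses (x2 : x ^+ 2 = 1) (y2 : y ^+ 2 = 1) (xyr : (x * y) ^+ r = 1).

Local Notation repr := (mx_representation 'F_p [set: T]%G).

Let cT : #|T| = r.*2.
Proof. by rewrite -cardsT (card_isog isoT) card_dihedral // ltnW. Qed.

Let nz2 : (2%:R != 0 :> 'F_p)%R.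
Proof.
rewrite -(dvdn_pcharf (pchar_Fp p_pr)) dvdn_prime2 //.
by apply/eqP=> p2; move: p_odd; rewrite p2.
Qed.

Definition fixed_ker n (rho : repr n) : 'M['F_p]_n := kermx (rho x - 1%:M)%R.

(** If x has no nonzero fixed vector, [nz_row] is zero and this is just [eta rho x]. The translation
    needed to leave the complement is then carried by [base_z]. *)
Definition base_a n (rho : repr n) : model rho :=
  nu rho (nz_row (fixed_ker rho)) * eta rho x.

Definition base_z n (rho : repr n) : model rho :=
  (if fixed_ker rho == 0%R then nu rho (const_mx 1%R) else 1) * eta rho y.

Definition base_map n (rho : repr n) := regmap (base_a rho) (base_z rho).

(* The one irreducible representation carrying no rotary PX map: x inverts N, so
   valency 2p is impossible, and y centralises N, so valency 2 is too. *)
Definition exceptional n (rho : repr n) :=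
  (rho x == - 1%:M)%R && (rho y == 1%:M)%R.

Lemma base_fixed n (rho : repr n) : fixed_ker rho != 0%R ->
  [/\ nz_row (fixed_ker rho) != 0%R,
      (nz_row (fixed_ker rho) *m rho x = nz_row (fixed_ker rho))%R
    & base_z rho = eta rho y].
Proof.
move=> nz; split; first by rewrite nz_row_eq0.
  have /sub_kermxP := nz_row_sub (fixed_ker rho).
  by rewrite mulmxBr mulmx1 => /eqP; rewrite subr_eq0 => /eqP.
by rewrite /base_z (negPf nz) mul1g.
Qed.

Lemma base_sign n (rho : repr n.+1) :
    mx_irreducible rho -> fixed_ker rho = 0%R -> ~~ exceptional rho ->
  [/\ n = 0%N, rho x = (- 1%:M)%R, rho y = (- 1%:M)%R &
      base_a rho = eta rho x /\ base_z rho = nu rho (const_mx 1%R) * eta rho y].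
Proof.
move=> irr k0; have [eX eY] := no_fixed_vector genT x2 y2 irr k0.
rewrite /exceptional eX eqxx /= => /eqP nY; case: eY => // eY.
split=> //.
  by apply: (scalar_dihedral_dim1 genT irr (a := (-1)%R) (b := (-1)%R)); rewrite raddfN.
split; last by rewrite /base_z k0 eqxx.
by rewrite /base_a k0 (_ : nz_row 0 = 0%R) ?nu0 ?mul1g //; apply/eqP; rewrite nz_row_eq0.
Qed.

Let const1_neq0 m : const_mx 1%R != 0%R :> 'rV['F_p]_m.+1.
Proof. by apply/eqP=> /rowP/(_ ord0); rewrite !mxE => /eqP; rewrite oner_eq0. Qed.

Lemma irr_degreeP n (rho : repr n) : mx_irreducible rho -> exists n', n = n'.+1.
Proof. by case/mx_irrP; case: n rho => // n' *; exists n'. Qed.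

Lemma base_gen n (rho : repr n) : mx_irreducible rho -> ~~ exceptional rho ->
  <<[set base_a rho; base_z rho]>> = setT.
Proof.
move=> irr; have [n' en] := irr_degreeP irr; case: _ / (esym en) in rho irr * => ne.
have [k0|nk] := eqVneq (fixed_ker rho) 0%R.
  have [n0 eX eY [-> ->]] := base_sign irr k0 ne.
  exact: (sign_map_gen p_pr pr genT x2 y2 xyr _ n0 eX eY).
have [nzv vX ->] := base_fixed nk.
exact: (fixed_map_gen p_pr p_odd genT x2 irr nzv vX).
Qed.

Lemma base_map_good n (rho : repr n) : mx_irreducible rho -> ~~ exceptional rho ->
  irr_rotary_aug_PX_map p r (base_map rho).
Proof.
move=> irr ne; have gen := base_gen irr ne.
have [n' en] := irr_degreeP irr; case: _ / (esym en) in rho irr ne gen *.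
have [z2 gi] : base_z rho ^+ 2 = 1 /\ aug_PX_map p r (base_map rho).
  have [k0|nk] := eqVneq (fixed_ker rho) 0%R.
    have [n0 eX eY [ea ez]] := base_sign irr k0 ne.
    rewrite /base_map ea ez; split; first exact: (sign_map_sqr y2).
    right; exact: sign_map_graph_iso.
  have [nzv vX ez] := base_fixed nk; rewrite /base_map ez; split.
    by rewrite -etaX y2 eta1.
  left; exists n'; exact: (PX_graph_iso p_pr p_odd r3 genT cT x2 y2 xyr irr nzv vX).
have mp : is_map (base_map rho).
  exact: (model_generators_is_map r3 genT cT x2 y2).
split=> //; first exact: regmap_rotary.
apply: irr_semidirect_isog (model_irr_semidirect p_pr isoT irr).
apply: isog_trans (mon_regmap_isog gen) _.
by rewrite isog_sym; apply: autp_isog_mon => //; apply: regmap_rotary.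
Qed.

Lemma scalar_dihedral_rsim n m (rho : repr n) (sigma : repr m) (a b : 'F_p) :
    mx_irreducible rho -> mx_irreducible sigma ->
    rho x = a%:M%R -> rho y = b%:M%R -> sigma x = a%:M%R -> sigma y = b%:M%R ->
  mx_rsim rho sigma.
Proof.
move=> irr irs rx ry sx sy.
have [n' en] := irr_degreeP irr; case: _ / (esym en) in rho irr rx ry *.
have [m' em] := irr_degreeP irs; case: _ / (esym em) in sigma irs sx sy *.
have n0 := scalar_dihedral_dim1 genT irr rx ry.
have m0 := scalar_dihedral_dim1 genT irs sx sy.
case: _ / (esym n0) in rho irr rx ry *; case: _ / (esym m0) in sigma irs sx sy *.
exists 1%:M%R => // [|g _]; first by rewrite row_free_unit unitmx1.
rewrite mulmx1 mul1mx.
have : g \in <<[set x; y]>> by rewrite genT inE.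
move=> /gen_prodgP[k [c cP ->]].
elim: k c cP => [|k IH] c cP; first by rewrite big_ord0 !repr_mx1.
rewrite big_ord_recr /= !repr_mxM ?inE // IH => [|i]; last exact: cP.
by congr (_ *m _)%R; case/set2P: (cP ord_max) => ->; rewrite ?rx ?ry ?sx ?sy.
Qed.

(* A morphism of models matching the dihedral generators restricts to an additive,
   hence F_p-linear, map of the Sylow p-subgroups. *)
Lemma model_morphism_rsim n m (rho : repr n) (sigma : repr m)
    (f : {morphism [set: model rho] >-> model sigma}) :
    'injm f -> #|model rho| = #|model sigma| ->
    p.-Hall([set: model sigma]) (Nmod sigma) ->
    f (eta rho x) = eta sigma x -> f (eta rho y) = eta sigma y -> mx_rsim rho sigma.
Proof.
move=> injf cM hall fx fy.
have fM s t : f (s * t) = f s * f t by rewrite morphM ?inE.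
have feta g : f (eta rho g) = eta sigma g.
  have : g \in <<[set x; y]>> by rewrite genT inE.
  move=> /gen_prodgP[k [c cP ->]].
  elim: k c cP => [|k IH] c cP; first by rewrite big_ord0 !eta1 morph1.
  rewrite big_ord_recr /= !etaM fM IH => [|i]; last exact: cP.
  by congr (_ * _); case/set2P: (cP ord_max) => ->.
have nN : Nmod sigma <| [set: model sigma] by case/sdprod_context: (model_sdprod sigma).
have fN w : f (nu rho w) \in Nmod sigma.
  rewrite (mem_normal_Hall hall nN) ?inE //; apply: morph_p_elt; rewrite ?inE //.
  have /abelemP[//|_ e] := abelem_Nmod p_pr rho.
  apply: (pnat_dvd (_ : _ %| p)); last exact: pnat_id.
  by rewrite order_dvdn e //; apply/mem_Nmod; exists w.
pose psi w := invm (injm_sdpair1 ('MR sigma)%gact) (f (nu rho w)).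
have psiE w : nu sigma (psi w) = f (nu rho w) by apply: invmK; apply: fN.
have psiD v w : psi (v + w)%R = (psi v + psi w)%R.
  by apply: (@nu_inj _ _ _ sigma); rewrite nuD !psiE nuD fM.
have psi0 : psi 0%R = 0%R.
  by apply: (@nu_inj _ _ _ sigma); rewrite psiE !nu0 morph1.
have psiZ (c : 'F_p) w : psi (c *: w)%R = (c *: psi w)%R.
  rewrite -(natr_Zp c) !scaler_nat; elim: (c : nat) => [|k IH].
    by rewrite !mulr0n psi0.
  by rewrite !mulrS psiD IH.
pose B := (\matrix_i psi (delta_mx 0 i))%R.
have psiB w : psi w = (w *m B)%R.
  rewrite [w in LHS]row_sum_delta (big_morph psi psiD psi0) mulmx_sum_row.
  by apply: eq_bigr => i _; rewrite psiZ rowK.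
have en : n = m.
  move: cM; rewrite !card_model // cT => /eqP.
  rewrite eqn_pmul2r ?double_gt0 ?(ltnW (ltnW r3)) //.
  by rewrite eqn_exp2l ?prime_gt1 // => /eqP.
exists B => // [|g _].
  apply: inj_row_free => w; rewrite -psiB => e; apply: (@nu_inj _ _ _ rho).
  apply: (injmP injf); rewrite ?inE //.
  by rewrite -psiE e nu0 nu0 morph1.
apply/row_matrixP=> i; rewrite !rowE !mulmxA -!psiB.
apply: (@nu_inj _ _ _ sigma); rewrite psiE -nuJ -nuJ psiE -feta.
by rewrite morphJ ?inE.
Qed.

(** The order of the base rotation, 2p or 2, tells whether x has a nonzero fixed vector; without one
    only x = y = -1 remains. With one, a and a^-1 have the same p-th power [eta x], so even an
    orientation-reversing isomorphism matches the dihedral generators. *)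
Lemma base_map_iso_rsim n m (rho : repr n) (sigma : repr m) :
    mx_irreducible rho -> mx_irreducible sigma ->
    ~~ exceptional rho -> ~~ exceptional sigma ->
  map_iso (base_map rho) (base_map sigma) -> mx_rsim rho sigma.
Proof.
move=> irr irs ner nes.
move=> /(regmap_iso_morphism (base_gen irr ner))[f [injf imf fz fa]].
have [n' en] := irr_degreeP irr; case: _ / (esym en) in rho irr ner f injf imf fz fa *.
have [m' em] := irr_degreeP irs; case: _ / (esym em) in sigma irs nes f injf imf fz fa *.
have oa : #[base_a rho] = #[base_a sigma].
  have <- : #[f (base_a rho)] = #[base_a rho] by rewrite order_injm ?inE.
  by case: fa => ->; rewrite ?orderV.
have p2 : p.*2 <> 2 by move=> e; have := prime_gt1 p_pr; rewrite -ltn_double e.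
have [k0|nk] := eqVneq (fixed_ker rho) 0%R.
  have [_ rx ry [ea _]] := base_sign irr k0 ner.
  have [k0'|nk'] := eqVneq (fixed_ker sigma) 0%R.
    have [_ sx sy _] := base_sign irs k0' nes.
    apply: (scalar_dihedral_rsim irr irs (a := (-1)%R) (b := (-1)%R));
      by rewrite raddfN.
  have [nzv vX _] := base_fixed nk'; case: p2.
  rewrite -(fixed_map_order p_pr p_odd r3 genT cT x2 y2 nzv vX) -[_ * _]/(base_a sigma).
  by rewrite -oa ea (sign_map_order rho r3 genT cT x2 y2).
have [nzv vX ez] := base_fixed nk.
have [k0'|nk'] := eqVneq (fixed_ker sigma) 0%R.
  have [_ sx sy [ea _]] := base_sign irs k0' nes; case: p2.
  rewrite -(fixed_map_order p_pr p_odd r3 genT cT x2 y2 nzv vX) -[_ * _]/(base_a rho).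
  by rewrite oa ea (sign_map_order sigma r3 genT cT x2 y2).
have [nzv' vX' ez'] := base_fixed nk'.
apply: (model_morphism_rsim injf).
- by rewrite -!cardsT -imf card_injm.
- exact: Nmod_Hall p_odd r3 pr cT.
- have <- := fixed_map_expp p_pr p_odd x2 nzv vX.
  rewrite morphX ?inE // -[_ * _]/(base_a rho).
  have e := fixed_map_expp p_pr p_odd x2 nzv' vX'.
  case: fa => ->; rewrite ?expgVn [X in X ^+ _]/(base_a sigma) e //.
  by rewrite -etaV involV.
- by rewrite -ez fz ez'.
Qed.

Section Recognition.

Variables (D : finType) (M : omap D) (n' : nat) (rho : repr n'.+1).
Hypotheses (mapM : is_map M) (rotM : rotary M) (irr : mx_irreducible rho).
Variable F : {morphism [set: model rho] >-> {perm D}}.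
Hypotheses (injF : 'injm F) (imF : F @* setT = mon M).
Variable w : 'rV['F_p]_n'.+1.
Hypothesis nzw : w != 0%R.

Let opp_neq (v : 'rV['F_p]_n'.+1) : v != 0%R -> v <> (- v)%R.
Proof.
move=> nzv e; case/negP: nzv; have : (v *+ 2 == 0)%R by rewrite mulr2n {1}e addNr.
by rewrite -scaler_nat scaler_eq0 (negPf nz2).
Qed.

Let comp_iso (G : {morphism [set: model rho] >-> model rho}) :
    'injm G -> G @* setT = setT -> F (G (base_a rho)) = mR M ->
    F (G (base_z rho)) = mL M -> map_iso M (base_map rho).
Proof.
move=> injG imG Fa Fz.
have FGM : {in [set: model rho] &, {morph (fun t => F (G t)) : s t / s * t}}.
  by move=> s t _ _; rewrite !morphM ?inE.
apply: (@mon_morphism_map_iso _ _ mapM rotM _ _ _ (Morphism FGM)) => //.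
  apply/injmP=> s t _ _ /= e; apply: (injmP injG); rewrite ?inE //.
  by apply: (injmP injF); rewrite ?inE.
rewrite -imF; apply/setP=> t; apply/morphimP/morphimP => [[s _ _ ->]|[s _ _ ->]].
  by exists (G s); rewrite ?inE.
have /morphimP[s' _ _ ->] : s \in G @* setT by rewrite imG inE.
by exists s'; rewrite ?inE.
Qed.

(** The vector read off from M and the base vector are both fixed by x, so [fixed_vector_transitive]
    provides an automorphism of the model carrying one to the other. *)
Lemma recognise_fixed : (w *m rho x)%R = w -> F (nu rho w) * F (eta rho x) = mR M ->
  F (eta rho y) = mL M -> ~~ exceptional rho /\ map_iso M (base_map rho).
Proof.
move=> wX FR FL.
have nk : fixed_ker rho != 0%R.
  apply: contra nzw => /eqP k0; rewrite -submx0 -k0; apply/sub_kermxP.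
  by rewrite mulmxBr mulmx1 wX subrr.
have [nzv vX ez] := base_fixed nk.
split.
  apply/negP=> /andP[/eqP eX _]; apply: (opp_neq nzw).
  by rewrite -{1}wX eX mulmxN mulmx1.
have [B [cB uB vB]] := fixed_vector_transitive genT x2 y2 irr nzv vX nz2 nzw wX.
have [G [injG imG G1 G2]] := centgmx_model_aut cB uB.
apply: (comp_iso injG imG); last by rewrite ez G2.
by rewrite /base_a (morphM G) ?inE // G1 G2 vB morphM ?inE.
Qed.

Lemma recognise_sign : n' = 0%N -> (w *m rho x)%R = (- w)%R ->
    (w *m rho y)%R = (- w)%R -> F (eta rho x) = mR M ->
    F (nu rho w) * F (eta rho y) = mL M ->
  ~~ exceptional rho /\ map_iso M (base_map rho).
Proof.
move=> n0 wX wY FR FL.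
have eX := opp_eigen_dim1 n0 nzw wX; have eY := opp_eigen_dim1 n0 nzw wY.
have k0 : fixed_ker rho = 0%R.
  apply/eqP/negP=> /negP nk; have [nzv vX _] := base_fixed nk.
  by apply: (opp_neq nzv); rewrite -{1}vX eX mulmxN mulmx1.
have ne : ~~ exceptional rho.
  apply/negP=> /andP[_ /eqP eY']; apply: (opp_neq nzw).
  by rewrite -wY eY' mulmx1.
have [_ _ _ [ea ez]] := base_sign irr k0 ne; split=> //.
pose B : 'M['F_p]_n'.+1 := ((w 0 0)%:M)%R.
have vB : (const_mx 1 *m B)%R = w.
  rewrite mul_mx_scalar; apply/rowP=> j; rewrite !mxE mulr1; congr (w _ _).
  by apply: val_inj; case: j => j /=; rewrite [in X in _ < X]n0; case: j.
have cB : centgmx rho B by apply/centgmxP=> g _; rewrite mul_scalar_mx mul_mx_scalar.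
have uB : B \in unitmx.
  apply: (mx_Schur irr cB); apply: contra nzw => /eqP B0.
  by rewrite -vB B0 mulmx0.
have [G [injG imG G1 G2]] := centgmx_model_aut cB uB.
apply: (comp_iso injG imG); first by rewrite ea G2.
by rewrite ez (morphM G) ?inE // G1 G2 vB morphM ?inE.
Qed.

End Recognition.

Lemma base_map_complete k (dims : 'I_k -> nat) (reps : forall i, repr (dims i)) :
    (forall i, mx_irreducible (reps i)) ->
    (forall n (rho : repr n), mx_irreducible rho -> exists i, mx_rsim rho (reps i)) ->
  forall (D : finType) (M : omap D), irr_rotary_aug_PX_map p r M ->
  exists2 i, ~~ exceptional (reps i) & map_iso M (base_map (reps i)).
Proof.
move=> irrs complete D M [mapM rotM augM irrM].
have := irr_semidirect_isog (autp_isog_mon mapM rotM) irrM.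
case/irr_semidirectP=> N [H [sd isoH abelN minN]].
have cH : #|H| = r.*2 by rewrite (card_isog isoH) card_dihedral // ltnW.
have L2 : mL M ^+ 2 = 1.
  by apply/permP=> d; rewrite expg2 permM perm1; case: mapM.
have cD := card_mon mapM rotM (map_dart mapM).
have gen : <<[set mR M; mL M]>> = mon M by [].
have r0 : 0 < r by rewrite ltnW // ltnW.
case: augM => [[s gi]|gi]; have [cA cV] := graph_iso_counts rotM gi.
  (* There are 2 r p^(s+1) arcs over r p^s vertices, for s = 0 as well. *)
  have oR : #[mR M] = p.*2.
    move: cV; rewrite /= !card_prod card_bool !card_ffun !card_ord.
    rewrite !Zp_cast ?(ltnW r3) ?(prime_gt1 p_pr) // => /eqP.
    rewrite expnSr !mulnA -mulnA eqn_pmul2l; last by rewrite muln_gt0 r0 expn_gt0 (prime_gt0 p_pr).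
    by rewrite muln2 => /eqP.
  have [[u2 uzr sd'] minN' cQ [Nv v1 vu avu]] :=
    frame_2p p_pr p_odd r3 pr sd isoH abelN minN gen L2 oR.
  have [n [rho [irr frame]]] := frame_repr p_pr genT cT x2 y2 xyr u2 L2 uzr sd' cQ abelN minN'.
  have [i sim] := complete _ _ irr; have [F [injF imF Fx Fy FN]] := frame _ _ sim.
  suff [? ?] : ~~ exceptional (reps i) /\ map_iso M (base_map (reps i)) by exists i.
  have [n' en] := irr_degreeP (irrs i).
  move: (irrs i) en F injF imF Fx Fy FN {frame sim}.
  move: (reps i); move: (dims i) => d sigma irs en; rewrite {}en in sigma irs *.
  move=> F injF imF Fx Fy FN.
  move: (Nv); rewrite -FN => /morphimP[t _ /mem_Nmod[w tw] ev]; rewrite {}tw {t} in ev.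
  apply: (recognise_fixed mapM rotM irs injF imF (w := w)) => //.
  - by apply: contra v1 => /eqP w0; rewrite ev w0 nu0 morph1.
  - apply: (@nu_inj _ _ _ sigma); apply: (injmP injF); rewrite ?inE //.
    by rewrite -nuJ morphJ ?inE // Fx -ev.
  - by rewrite Fx -ev.
have oR : #[mR M] = 2.
  move: cV; rewrite /= card_prod card_bool card_ord => /eqP.
  by rewrite eqn_pmul2l // => /eqP.
(* The regular group has as many elements as the cycle of length pr has arcs, so 2r times the order
   of N is 2pr. *)
have cN : #|N| = p.
  move: cD; rewrite cA -(sdprod_card sd) cH /= card_prod card_bool card_ord Zp_cast.
    by rewrite muln2 doubleMr => /eqP; rewrite eqn_pmul2r ?double_gt0 // => /eqP.
  by rewrite (leq_trans (prime_gt1 p_pr)) // leq_pmulr.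
have [y' [v [[a2 y'2 ayr sd'] minN' cQ [Nv v1 zE [va vy]]]]] :=
  frame_2 p_pr r3 pr sd isoH abelN minN gen L2 oR cN.
have [n [rho [irr frame]]] := frame_repr p_pr genT cT x2 y2 xyr a2 y'2 ayr sd' cQ abelN minN'.
have [i sim] := complete _ _ irr; have [F [injF imF Fx Fy FN]] := frame _ _ sim.
suff [? ?] : ~~ exceptional (reps i) /\ map_iso M (base_map (reps i)) by exists i.
have [n' en] := irr_degreeP (irrs i).
move: (irrs i) en F injF imF Fx Fy FN {frame sim}.
move: (reps i); move: (dims i) => d sigma irs en; rewrite {}en in sigma irs *.
move=> F injF imF Fx Fy FN.
move: (Nv); rewrite -FN => /morphimP[t _ /mem_Nmod[w tw] ev]; rewrite {}tw {t} in ev.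
apply: (recognise_sign mapM rotM irs injF imF (w := w)) => //.
- by apply: contra v1 => /eqP w0; rewrite ev w0 nu0 morph1.
- move: cN; rewrite -FN card_injm ?subsetT // card_injm ?subsetT ?injm_sdpair1 //.
  rewrite cardsT card_mx mul1n card_Fp // -{2}(expn1 p) => /eqP.
  by rewrite eqn_exp2l ?prime_gt1 // eqSS => /eqP.
- apply: (@nu_inj _ _ _ sigma); apply: (injmP injF); rewrite ?inE //.
  by rewrite -nuJ morphJ ?inE // Fx -ev va nuN morphV ?inE // -ev.
- apply: (@nu_inj _ _ _ sigma); apply: (injmP injF); rewrite ?inE //.
  by rewrite -nuJ morphJ ?inE // Fy -ev vy nuN morphV ?inE // -ev.
- by rewrite Fy -ev.
Qed.

End IrreducibleMaps.

(** In coprime characteristic the regular representation is semisimple and contains every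
    irreducible one, so the components of its socle index the similarity classes. *)
Lemma num_irr_reps_exists (F : decFieldType) (gT : finGroupType) (G : {group gT}) :
  [pchar F]%R^'.-group G -> exists k, num_irr_reps F G k.
Proof.
move=> F'G; pose sG : irrType F G := DecSocleType (regular_repr F G).
exists #|sG|, (fun i => irr_degree (enum_val i : sG)), (fun i => irr_repr (enum_val i)).
split=> [i|i j sim|n rho irr]; first exact: socle_irr.
  apply: enum_val_inj; have := irr_comp_rsim_pchar sG F'G sim.
  by rewrite !irr_reprK_pchar.
exists (enum_rank (irr_comp sG rho)); rewrite enum_rankK.
exact: rsim_irr_comp_pchar.
Qed.

(** * The exceptional representation and the parity of r *)

Section ExceptionalCount.

Variables (p r : nat) (T : finGroupType) (x y : T).
Hypotheses (p_pr : prime p) (p_odd : odd p) (r3 : 2 < r).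
Hypotheses (genT : <<[set x; y]>> = setT) (cT : #|T| = r.*2).
Hypotheses (x2 : x ^+ 2 = 1) (y2 : y ^+ 2 = 1) (xyr : (x * y) ^+ r = 1).
Local Notation repr := (mx_representation 'F_p [set: T]%G).

(** The rotation xy acts as -1 and its r-th power is trivial, while -1 differs from 1 in odd
    characteristic. *)
Lemma exceptional_even n (rho : repr n) :
  mx_irreducible rho -> exceptional x y rho -> ~~ odd r.
Proof.
move=> irr /andP[/eqP eX /eqP eY]; apply/negP=> r_odd.
have eA k : rho ((x * y) ^+ k) = (((-1) ^+ k)%:M)%R.
  elim: k => [|k IH]; first by rewrite expg0 repr_mx1 expr0.
  rewrite expgSr !repr_mxM ?inE // IH eX eY mulmx1 mulmxN mulmx1 exprSr mulrN1.
  by rewrite raddfN.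
have := eA r; rewrite xyr repr_mx1 -signr_odd r_odd expr1.
have [n' en] := irr_degreeP irr; case: _ / (esym en) => /matrixP/(_ 0%R 0%R).
rewrite !mxE eqxx /= !mulr1n => /eqP; rewrite -subr_eq0 opprK -[X in (X + X)%R]/(1%:R)%R.
rewrite -natrD -(dvdn_pcharf (pchar_Fp p_pr)) dvdn_prime2 // => /eqP p2.
by move: p_odd; rewrite p2.
Qed.

Lemma exceptional_rsim n m (rho : repr n) (sigma : repr m) :
    mx_irreducible rho -> mx_irreducible sigma ->
  exceptional x y rho -> exceptional x y sigma -> mx_rsim rho sigma.
Proof.
move=> irr irs /andP[/eqP rx /eqP ry] /andP[/eqP sx /eqP sy].
by apply: (scalar_dihedral_rsim genT irr irs (a := (-1)%R) (b := 1%R)) => //; rewrite raddfN.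
Qed.

Lemma exceptional_rsimE n m (rho : repr n) (sigma : repr m) :
  mx_rsim rho sigma -> exceptional x y rho -> exceptional x y sigma.
Proof.
move=> sim /andP[/eqP rx /eqP ry]; apply/andP; split; apply/eqP.
  rewrite -raddfN; apply: (mx_rsim_scalar _ sim); rewrite ?inE //.
  by rewrite raddfN.
by apply: (mx_rsim_scalar _ sim); rewrite ?inE.
Qed.

(** The linear character arises from the pair (-1, 1) in the unit group of F_p, whose product has
    trivial r-th power for even r. *)
Lemma exceptional_exists : ~~ odd r ->
  exists rho : repr 1, mx_irreducible rho /\ exceptional x y rho.
Proof.
move=> r_even; have uN : (-1 : 'F_p)%R \is a GRing.unit by rewrite unitrN unitr1.
pose e : {unit 'F_p} := FinRing.unit 'F_p uN.
have e2 : e ^+ 2 = 1 by apply: val_inj; rewrite /= mulrNN mulr1.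
have er : (e * 1) ^+ r = 1.
  rewrite mulg1 -(odd_double_half r) (negPf r_even) add0n -mul2n expgM e2.
  exact: expg1n.
have [f [fx fy]] := invol_pair_morphism genT cT x2 y2 xyr e2 (expg1n _ 2) er.
have rhoP : mx_repr [set: T]%G (fun g => ((val (f g))%:M : 'M['F_p]_1)%R).
  split=> [|g h _ _]; first by rewrite morph1.
  by rewrite morphM ?inE //= scalar_mxM.
exists (MxRepresentation rhoP); split.
  apply/mx_irrP; split=> // U _ nzU; rewrite /row_full eqn_leq rank_leq_col.
  by rewrite lt0n mxrank_eq0.
by rewrite /exceptional /= fx fy /= raddfN !eqxx.
Qed.

End ExceptionalCount.

Theorem theorem5p7 (p r : nat) :
  prime p -> odd p -> 3 <= r -> ~~ (p %| r) ->
  exists k : nat,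
    num_irr_reps 'F_p [set: 'D_(r.*2)]%G k /\
    num_irr_rotary_aug_PX_maps p r (if odd r then k else k.-1).
Proof.
move=> p_pr p_odd r3 pr.
have [x [y [x2 y2 xyr genT]]] := dihedral_gens (ltnW r3).
have cT := card_dihedral (ltnW r3); rewrite cardsT in cT.
have p'T : [pchar 'F_p]%R^'.-group [set: 'D_(r.*2)].
  rewrite (eq_pgroup _ (eq_negn (pcharf_eq (pchar_Fp p_pr)))) /pgroup cardsT cT.
  rewrite p'natE //; apply: contra pr; rewrite -muln2 Euclid_dvdM // => /orP[//|].
  by rewrite dvdn_prime2 // => /eqP p2; rewrite p2 in p_odd.
have [k irrk] := @num_irr_reps_exists 'F_p _ _ p'T; exists k; split=> //.
case: irrk => dims [reps [irrs distinct complete]].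
pose E := [set i | ~~ exceptional x y (reps i)].
have <- : #|E| = if odd r then k else k.-1.
  have -> : E = ~: [set i | exceptional x y (reps i)].
    by apply/setP=> i; rewrite !inE.
  rewrite cardsCs setCK card_ord.
  have [r_odd|r_even] := boolP (odd r).
    rewrite (_ : [set i | _] = set0) ?cards0 ?subn0 //.
    apply/setP=> i; rewrite !inE; apply/negP=> /(exceptional_even p_pr p_odd xyr (irrs i)).
    by rewrite r_odd.
  (* Completeness puts the exceptional character in the list, and distinctness leaves it a single
     index. *)
  have [rho [irr ex]] := exceptional_exists p genT cT x2 y2 xyr r_even.
  have [i0 sim] := complete _ _ irr; have ex0 := exceptional_rsimE sim ex.
  rewrite (_ : [set i | _] = [set i0]) ?cards1 ?subn1 //.
  apply/setP=> i; rewrite !inE; apply/idP/eqP => [exi|-> //].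
  by apply: distinct; apply: (exceptional_rsim genT).
have nexE (i : 'I_#|E|) : ~~ exceptional x y (reps (enum_val i)).
  by have := enum_valP i; rewrite inE.
exists (fun i : 'I_#|E| => model (reps (enum_val i)) : finType).
exists (fun i => base_map x y (reps (enum_val i))); split.
- move=> i; exact: (base_map_good p_pr p_odd r3 pr genT (isog_refl _) x2 y2 xyr).
- move=> i j iso; apply: enum_val_inj; apply: distinct.
  exact: (base_map_iso_rsim p_pr p_odd r3 pr genT (isog_refl _) x2 y2 xyr _ _ _ _ iso).
- move=> D M irrM.
  have [i nei iso] := base_map_complete p_pr p_odd r3 pr genT (isog_refl _) x2 y2 xyr
    irrs complete irrM.
  have Ei : i \in E by rewrite inE.
  by exists (enum_rank_in Ei i); rewrite enum_rankK_in.
Qed.
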